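(* Let $2\le n<\infty$, and let $P=(p_{ij})_{1\le i,j\le n}$ be an irreducible, aperiodic transition matrix reversible with respect to a probability vector $\pi=(\pi_i)_{1\le i\le n}$. Write $\pi_*=\min_{1\le j\le n}\pi_j$, $\pi^*=\max_{1\le j\le n}\pi_j$, and let $\gamma^{(2)}$ be the spectral gap of the two-step chain with transition matrix $P^2$. Let $\mathbf{X}(t)=(X_i(t))_{1\le i\le n}$ be the potlatch process associated with $P$. Starting from any (possibly random) initial configuration $\mathbf{X}(0)=(X_i(0))_{1\le i\le n}\ge 0$, the process $\mathbf{X}(t)$ converges weakly to a random vector $\mathbf{X}(\infty)$ as $t\to\infty$. Moreover, for any $t\ge 0$, $$d^{(2)}_W\big(\mathcal{D}(\mathbf{X}(t)),\mathcal{D}(\mathbf{X}(\infty))\big)\le \sqrt{\frac{2\pi^*}{\pi_*}\,n\,\mathbb{E}\left[\left(\sum_{j=1}^nX_j(0)\right)^2\right]}\;\exp\left(-\gamma^{(2)}t/2\right).$$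
   Context: Reversibility means $\pi_i p_{ij}=\pi_j p_{ji}$ for all $i,j$. Potlatch process: sites are $\{1,\dots,n\}$; each site carries a unit-intensity Poisson process (clock); all clocks are jointly independent and independent of $\mathbf{X}(0)$. When the clock at $i$ rings at time $t$, the mass at $i$ becomes $X_i(t)=p_{ii}X_i(t-)$ and for each $j\ne i$ the mass at $j$ becomes $X_j(t)=X_j(t-)+p_{ij}X_i(t-)$. $\mathcal{D}(\cdot)$ denotes the distribution of a random object. $d_W^{(2)}(\mu,\nu)$ is the $L^2$-Wasserstein distance, $\big(\inf \mathbb{E}|U-V|^2\big)^{1/2}$, with infimum over all couplings $(U,V)$ of $\mu$ and $\nu$ and $|\cdot|$ the Euclidean norm. Let $1=\lambda_0>\lambda_1\ge\dots\ge\lambda_{n-1}>-1$ be the eigenvalues of $P$ and $\lambda_*=\max\{|\lambda_i|:\lambda_i<1\}$. The spectral gap of the two-step chain is $\gamma^{(2)}=1-\lambda_*^2$. If the expectation on the right-hand side is infinite, the bound is understood as trivially true. *)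

(* Defs.v *)
From HB Require Import structures.
From mathcomp Require Import all_boot all_order all_algebra.
From mathcomp Require Import all_classical all_reals all_analysis.

Set Implicit Arguments.
Unset Strict Implicit.
Unset Printing Implicit Defensive.

Import Order.TTheory GRing.Theory Num.Theory.
Import numFieldNormedType.Exports.

Local Open Scope classical_set_scope.
Local Open Scope ring_scope.

Section MarkovChain.
Context {R : realType} {n : nat}.
Implicit Types (P : 'M[R]_n) (p : 'I_n -> R).

Definition transition_matrix P :=
  (forall i j, 0 <= P i j) /\ (forall i, \sum_j P i j = 1).

Definition irreducible P := forall i j, exists k : nat, 0 < (P ^+ k) i j.

(* For every i, the gcd of the positive return times of i is 1. *)
Definition aperiodic P := forall i (d : nat),
  (forall k : nat, (0 < k)%N -> 0 < (P ^+ k) i i -> (d %| k)%N) -> d = 1%N.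

Definition probability_vector p := (forall i, 0 <= p i) /\ \sum_i p i = 1.

Definition reversible P p := forall i j, p i * P i j = p j * P j i.

(* The default values 1 and 0 are neutral, as the entries of a probability
   vector are in [0, 1]. *)
Definition pi_min p : R := \big[Num.min/1]_i p i.
Definition pi_max p : R := \big[Num.max/0]_i p i.

(* The set of eigenvalues is finite, so this supremum is a maximum. *)
Definition lambda_star P : R :=
  sup [set `|l| | l in [set l : R | eigenvalue P l /\ l < 1]].

Definition gap2 P : R := 1 - lambda_star P ^+ 2.

Definition potlatch_move P (i : 'I_n) (x : 'rV[R]_n) : 'rV[R]_n :=
  \row_j (if j == i then P i i * x ord0 i else x ord0 j + P i j * x ord0 i).

End MarkovChain.

Notation borelRV R n := (g_sigma_algebraType (@open 'rV[R]_n)).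

Section Independence.
Context {d : measure_display} {T : measurableType d} {R : realType}.
Variable Pr : probability T R.

Definition mutually_independent {I : eqType} (F : I -> set (set T)) :=
  forall (J : seq I) (A : I -> set T), uniq J ->
    (forall i, i \in J -> F i (A i)) ->
    Pr (\bigcap_(i in [set` J]) A i) = (\prod_(i <- J) Pr (A i))%E.

Definition sigma_rv {d' : measure_display} {T' : measurableType d'}
    (X : T -> T') : set (set T) :=
  preimage_set_system setT X measurable.

Definition sigma_process {d' : measure_display} {T' : measurableType d'}
    (X : R -> T -> T') : set (set T) :=
  <<s \bigcup_(t in `[0, +oo[) sigma_rv (X t) >>.

End Independence.

Section Potlatch.
Context {d : measure_display} {T : measurableType d} {R : realType}.
Variable Pr : probability T R.

(* N t counts the rings of the clock in ]0, t]; only times t >= 0 matter.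
   Paths are almost surely nondecreasing, so the truncated subtraction in
   incr is almost surely the genuine increment. *)
Definition incr (N : R -> T -> nat) (s t : R) (w : T) : nat :=
  (N t w - N s w)%N.

Record unit_poisson_process (N : R -> {RV Pr >-> nat}) : Prop := {
  poisson_zero : {ae Pr, forall w, N 0 w = 0%N};
  poisson_increment : forall (s t : R) (k : nat), 0 <= s -> s < t ->
    Pr [set w | incr N s t w = k] = (poisson_pmf (t - s) k)%:E;
  poisson_independent_increments : forall u : nat -> R, 0 <= u 0%N ->
    {homo u : k l / (k <= l)%N >-> k <= l} ->
    mutually_independent Pr (fun k : nat => sigma_rv (incr N (u k) (u k.+1)));
  poisson_paths : {ae Pr, forall w,
    (forall s t : R, 0 <= s -> s <= t -> (N s w <= N t w)%N) /\
    (forall t : R, 0 <= t -> \forall s \near t^'+, N s w = N t w)} }.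

(* On a nondecreasing path, this says that N jumps at time t. *)
Definition rings (N : R -> T -> nat) (t : R) (w : T) :=
  0 < t /\ forall s : R, 0 <= s -> s < t -> (N s w < N t w)%N.

Section Sites.
Context {n : nat}.

(* None indexes the initial configuration, Some i the clock at site i. *)
Definition clocks (N : 'I_n -> R -> {RV Pr >-> nat})
    (X0 : {RV Pr >-> borelRV R n}) :=
  (forall i, unit_poisson_process (N i)) /\
  mutually_independent Pr (fun o : option 'I_n =>
    if o is Some i then sigma_process (N i) else sigma_rv X0).

(* The dynamics is almost sure: simultaneous rings are excluded only up to a
   null event. *)
Record potlatch_process (P : 'M[R]_n) (N : 'I_n -> R -> {RV Pr >-> nat})
    (X : R -> {RV Pr >-> borelRV R n}) : Prop := {
  potlatch_clocks : clocks N (X 0);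
  potlatch_ring : {ae Pr, forall w, forall (i : 'I_n) (t : R),
    rings (N i) t w ->
    X t w = potlatch_move P i (lim ((X s w : 'rV[R]_n) @[s --> t^'-]))};
  potlatch_constant : {ae Pr, forall w, forall s t : R, 0 <= s -> s <= t ->
    (forall (i : 'I_n) (r : R), s < r -> r <= t -> ~ rings (N i) r w) ->
    X t w = X s w} }.

End Sites.
End Potlatch.

Section LawsOnRn.
Context {R : realType} {n : nat}.
Local Open Scope ereal_scope.

Definition weak_cvg (mu : R -> probability (borelRV R n) R)
    (nu : probability (borelRV R n) R) :=
  forall f : 'rV[R]_n -> R, continuous f ->
    (exists M : R, forall x, (`|f x| <= M)%R) ->
    \int[mu t]_x (f x)%:E @[t --> +oo%R] --> \int[nu]_x (f x)%:E.

Definition coupling (mu nu : probability (borelRV R n) R)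
    (Q : probability (borelRV R n * borelRV R n)%type R) :=
  (forall A, measurable A -> Q (A `*` setT) = mu A) /\
  (forall A, measurable A -> Q (setT `*` A) = nu A).

(* The library norm on 'rV is the sup norm, not the Euclidean one. *)
Definition euclid_sq (x : 'rV[R]_n) : R := (\sum_i x ord0 i ^+ 2)%R.

Definition wasserstein2 (mu nu : probability (borelRV R n) R) : \bar R :=
  sqrte (ereal_inf [set \int[Q]_z
    (euclid_sq ((z.1 : 'rV[R]_n) - (z.2 : 'rV[R]_n)))%:E |
      Q in coupling mu nu]).

End LawsOnRn.

(* Main.v *)
Require Import Defs.
From HB Require Import structures.
From mathcomp Require Import all_boot all_order all_algebra.
From mathcomp Require Import all_classical all_reals all_analysis.
From mathcomp Require Import measurable_realfun ring lra.

Set Implicit Arguments.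
Unset Strict Implicit.
Unset Printing Implicit Defensive.

Import Order.TTheory GRing.Theory Num.Theory.
Import numFieldNormedType.Exports.

Local Open Scope classical_set_scope.
Local Open Scope ring_scope.

(** A ring of clock i acts linearly: it sends the row vector x to x A_i, where
    A_i is the identity matrix with row i replaced by row i of P.  Hence X(t)
    is X(0) A_{i_1} ... A_{i_k}, where i_1, ..., i_k are the sites that rang up
    to time t, in that order; their number is Poisson of parameter n t and they
    are independent and uniform.

    The law of the product does not change when the factors are multiplied in
    the opposite order ([iter_rmean_lmean]), and the reversed products
    B_k = A_{i_k} ... A_{i_1} converge almost surely: a further ring multiplies
    on the left, so it replaces a row of B_k by a convex combination of its
    rows, and every column is averaged towards a constant.  If nu is the common
    limit of the rows, then X(oo) = (\sum_j X_j(0)) nu, and the pair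
    (X(0) B_K, X(oo)) with K an independent Poisson variable couples X(t) and
    X(oo) ([coupled_random_law]).

    For the rate, let f be a column of B_k.  In L^2(pi) a step multiplies the
    expected variance of f by at most rho = 1 - (1 - mu) / n ([lmean_var_le]),
    where mu bounds |P h|^2 / |h|^2 over the h of mean 0; such a mu, with
    mu < 1 and mu <= lambda_*^2, comes from [spectral_gap].  The mean of f is a
    martingale and the expected square norm of f decreases, so the square
    distance from f to its limit is at most twice the variance of f
    ([iter_lmean_dist2_le]).  Summing over the columns, the coupling costs at
    most 2 rho^K / pi_min times the second moment of the total mass, and the
    mean of rho^K is exp(- (1 - mu) t) ([coupling_cost_le]).  The constant of
    the theorem follows because 1 <= n pi_max.  Weak convergence, for any
    law of X(0), follows from the almost sure convergence of X(0) B_k and from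
    the fact that K leaves every bounded set as t grows ([expectation_cvg]).

    The description of the law of X(t) comes from cutting [0, t] into K equal
    intervals.  On the event that each interval contains at most one ring, with
    a prescribed list of sites, X(t) is a prescribed product applied to X(0),
    and independence gives the probability of that event
    ([sum_word_events_le]).  Letting K grow bounds P(X(t) in A) from below by
    the Poisson mixture ([poisson_sum_le]); as both sides are probabilities in
    A, they are equal.

    All the B_k live on [0, 1] with the uniform law: the base n digits of a
    uniform number are independent uniform sites. *)

(** * The chain as an operator on functions *)

(** Twice the difference of the two sides is the sum of the
    w_i w_j (a_i - a_j)^2. *)
Lemma jensen_sqr (R : realType) (I : finType) (w a : I -> R) : (forall i, 0 <= w i) ->
  (\sum_i w i * a i) ^+ 2 <= (\sum_i w i) * \sum_i w i * a i ^+ 2.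
Proof.
move=> w0; rewrite -subr_ge0.
have -> : (\sum_i w i) * (\sum_i w i * a i ^+ 2) - (\sum_i w i * a i) ^+ 2 =
   2^-1 * \sum_i \sum_j w i * w j * (a i - a j) ^+ 2.
  have e1 : \sum_i \sum_j w i * w j * a i ^+ 2 =
     (\sum_i w i) * (\sum_i w i * a i ^+ 2).
    rewrite mulrC mulr_suml; apply: eq_bigr => i _; rewrite mulr_sumr.
    by apply: eq_bigr => j _; ring.
  have e2 : \sum_i \sum_j w i * w j * a j ^+ 2 =
     (\sum_i w i) * (\sum_i w i * a i ^+ 2).
    by rewrite exchange_big -e1; do 2!apply: eq_bigr => ? _; ring.
  have e3 : \sum_i \sum_j w i * w j * (a i * a j) = (\sum_i w i * a i) ^+ 2.
    rewrite expr2 mulr_suml; apply: eq_bigr => i _; rewrite mulr_sumr.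
    by apply: eq_bigr => j _; ring.
  transitivity (2^-1 * (\sum_i \sum_j w i * w j * a i ^+ 2 +
      \sum_i \sum_j w i * w j * a j ^+ 2 -
      2 * \sum_i \sum_j w i * w j * (a i * a j))).
    by rewrite e1 e2 e3; field.
  congr (_ * _); rewrite mulr_sumr -sumrN -!big_split /=.
  apply: eq_bigr => i _; rewrite mulr_sumr -sumrN -!big_split /=.
  by apply: eq_bigr => j _; ring.
apply: mulr_ge0 => //; apply: sumr_ge0 => i _; apply: sumr_ge0 => j _.
by rewrite mulr_ge0 ?sqr_ge0// mulr_ge0.
Qed.

Lemma continuous_sum (R : realType) (T : topologicalType) (I : finType)
    (F : I -> T -> R) :
  (forall i, continuous (F i)) -> continuous (fun x => \sum_i F i x).
Proof.
by move=> cF; apply: continuous_big => [|i _]; [exact: add_continuous|exact: cF].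
Qed.

Section Averaging.
Context {R : realType} {n : nat}.
Variables (P : 'M[R]_n) (p : 'I_n -> R).
Implicit Types (g h : 'I_n -> R) (i j : 'I_n).

Definition avg h i := \sum_j P i j * h j.
Definition mean h := \sum_i p i * h i.
Definition dotp g h := \sum_i p i * (g i * h i).

Lemma dotp_lincomb (a b : R) g h :
  dotp (fun i => a * g i + b * h i) (fun i => a * g i + b * h i) =
  a ^+ 2 * dotp g g + 2 * a * b * dotp g h + b ^+ 2 * dotp h h.
Proof.
rewrite /dotp !mulr_sumr -!big_split /=; apply: eq_bigr => i _; ring.
Qed.

Lemma avg_lincomb (a b : R) g h :
  avg (fun i => a * g i + b * h i) = (fun i => a * avg g i + b * avg h i).
Proof.
apply/funext => i; rewrite /avg !mulr_sumr -!big_split /=.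
by apply: eq_bigr => j _; ring.
Qed.

Lemma mean_lincomb (a b : R) g h :
  mean (fun i => a * g i + b * h i) = a * mean g + b * mean h.
Proof.
by rewrite /mean !mulr_sumr -!big_split /=; apply: eq_bigr => j _; ring.
Qed.

Lemma avgZ (a : R) h : avg (fun i => a * h i) = (fun i => a * avg h i).
Proof.
by apply/funext => i; rewrite /avg mulr_sumr; apply: eq_bigr => j _; ring.
Qed.

Lemma meanZ (a : R) h : mean (fun i => a * h i) = a * mean h.
Proof. by rewrite /mean mulr_sumr; apply: eq_bigr => j _; ring. Qed.

Lemma dotpZ (a : R) h :
  dotp (fun i => a * h i) (fun i => a * h i) = a ^+ 2 * dotp h h.
Proof. by rewrite /dotp mulr_sumr; apply: eq_bigr => j _; ring. Qed.

Hypotheses (hP : transition_matrix P) (hp : probability_vector p).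
Hypothesis hrev : reversible P p.

Let P0 i j : 0 <= P i j. Proof. by case: hP. Qed.
Let P1 i : \sum_j P i j = 1. Proof. by case: hP. Qed.
Let p0 i : 0 <= p i. Proof. by case: hp. Qed.
Let p1 : \sum_i p i = 1. Proof. by case: hp. Qed.

Lemma stationary j : \sum_i p i * P i j = p j.
Proof. by under eq_bigr do rewrite hrev; rewrite -mulr_sumr P1 mulr1. Qed.

Lemma pow_transition k : transition_matrix (P ^+ k).
Proof.
elim: k => [|k [IH0 IH1]].
  split=> [i j|i]; first by rewrite expr0 mxE; case: eqP.
  rewrite (bigD1 i)//= big1 ?addr0; first by rewrite expr0 mxE eqxx.
  by move=> j /negbTE ji; rewrite expr0 mxE eq_sym ji.
rewrite exprS; split=> [i j|i].
  by rewrite mxE; apply: sumr_ge0 => l _; rewrite mulr_ge0.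
under eq_bigr do rewrite mxE.
by rewrite exchange_big /=; under eq_bigr do rewrite -mulr_sumr IH1 mulr1.
Qed.

Lemma pow_stationary k j : \sum_i p i * (P ^+ k) i j = p j.
Proof.
elim: k j => [|k IH] j.
  rewrite (bigD1 j)//= big1 ?addr0; first by rewrite expr0 mxE eqxx mulr1.
  by move=> i /negbTE ji; rewrite expr0 mxE ji mulr0.
rewrite exprSr -[RHS]stationary.
under eq_bigr do rewrite mxE mulr_sumr.
rewrite exchange_big /=; apply: eq_bigr => l _.
by rewrite -[X in _ = X * _]IH mulr_suml; apply: eq_bigr => i _; rewrite mulrA.
Qed.

Lemma stationary_gt0 : irreducible P -> forall j, 0 < p j.
Proof.
move=> irr j.
have [i pi_gt0] : exists i, 0 < p i.
  apply/not_existsP => H; have : \sum_i p i <= 0.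
    by apply: sumr_le0 => i _; rewrite leNgt; apply/negP/H.
  by rewrite p1 leNgt ltr01.
have [k Pk] := irr i j.
rewrite -(pow_stationary k j) (bigD1 i)//= ltr_wpDr ?mulr_gt0//.
by apply: sumr_ge0 => l _; rewrite mulr_ge0//; case: (pow_transition k).
Qed.

Lemma mean_avg h : mean (avg h) = mean h.
Proof.
rewrite /mean /avg; under eq_bigr do rewrite mulr_sumr.
rewrite exchange_big; apply: eq_bigr => j _.
by under eq_bigr do rewrite mulrA; rewrite -mulr_suml stationary.
Qed.

(** Detailed balance says that the chain is self-adjoint in L^2(p). *)
Lemma dotp_avg g h : dotp (avg g) h = dotp g (avg h).
Proof.
rewrite /dotp /avg; under eq_bigr do rewrite mulr_suml mulr_sumr.
rewrite exchange_big; apply: eq_bigr => j _; rewrite !mulr_sumr.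
apply: eq_bigr => i _.
by rewrite !mulrA hrev; ring.
Qed.

Lemma dotp_ge0 h : 0 <= dotp h h.
Proof. by apply: sumr_ge0 => i _; rewrite mulr_ge0// -expr2 sqr_ge0. Qed.

Lemma dotp_avg_le h : dotp (avg h) (avg h) <= dotp h h.
Proof.
rewrite -[leRHS](mean_avg (fun i => h i * h i)) /dotp /mean.
apply: ler_sum => i _; apply: ler_wpM2l => //.
rewrite -expr2 (le_trans (jensen_sqr _ (P0 i)))// P1 mul1r.
by rewrite le_eqVlt; apply/orP; left; apply/eqP/eq_bigr => j _; rewrite expr2.
Qed.

Lemma pow_harmonic (l : R) h k :
  avg h = (fun i => l * h i) ->
  forall i, \sum_j (P ^+ k) i j * h j = l ^+ k * h i.
Proof.
move=> E; elim: k => [|k IH] i.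
  rewrite (bigD1 i)//= big1 ?addr0; first by rewrite expr0 mxE eqxx.
  by move=> j /negbTE ji; rewrite expr0 mxE eq_sym ji mul0r.
rewrite exprS; under eq_bigr do rewrite mxE mulr_suml.
rewrite exchange_big /=.
under eq_bigr => m _ do under eq_bigr do rewrite -mulrA.
under eq_bigr => m _ do rewrite -mulr_sumr IH mulrCA.
rewrite -mulr_sumr.
have -> : \sum_m P i m * h m = l * h i by rewrite -[LHS]/(avg h i) E.
by rewrite exprSr mulrA.
Qed.


(** The equality case behind the two maximum principles below. *)
Lemma convex_max_eq (w a : 'I_n -> R) (c : R) :
  (forall i, 0 <= w i) -> \sum_i w i = 1 -> (forall i, a i <= c) ->
  \sum_i w i * a i = c -> forall i, 0 < w i -> a i = c.
Proof.
move=> w0 w1 ac E i wi.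
have S0 : \sum_i w i * (c - a i) = 0.
  under eq_bigr do rewrite mulrBr.
  by rewrite sumrB -mulr_suml w1 mul1r E subrr.
have /psumr_eq0P/(_ S0 i isT)/eqP : forall j, true -> 0 <= w j * (c - a j).
  by move=> j _; rewrite mulr_ge0// subr_ge0.
by rewrite mulf_eq0 gt_eqF//= subr_eq0 => /eqP.
Qed.

(** At a maximum m of h, the number h m is an average of values of h against
    row m of P^k, so h equals h m at every site that m reaches in k steps. *)
Lemma harmonic_constant h : irreducible P -> avg h = h -> forall i j, h i = h j.
Proof.
move=> irr hh i0 j0.
have [m _ hm] := @Order.TotalTheory.arg_maxP _ _ _ i0 xpredT h isT.
suff H j : h j = h m by rewrite !H.
have [k Pk] := irr m j.
have [Q0 Q1] := pow_transition k.
apply: (convex_max_eq (Q0 m) (Q1 m)) Pk => [l|]; first exact: hm.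
rewrite (@pow_harmonic 1); first by rewrite expr1n mul1r.
by rewrite hh; apply/funext => i; rewrite mul1r.
Qed.

(** Let |h| be maximal at m.  If P^k returns from m to m, the equality case of
    the triangle inequality gives h m = (-1)^k h m; unless h vanishes, every
    return time is even. *)
Lemma antiharmonic_zero h :
  aperiodic P -> avg h = (fun i => - h i) -> forall i, h i = 0.
Proof.
move=> aper hh i0.
have [m _ hm] := @Order.TotalTheory.arg_maxP _ _ _ i0 xpredT (fun i => `|h i|) isT.
have [hm0|hm0] := eqVneq (h m) 0.
  by apply/eqP; rewrite -normr_le0; have := hm i0 isT; rewrite hm0 normr0.
have : 2%N = 1%N; last by [].
apply: (aper m) => k k0 Pk.
have [Q0 Q1] := pow_transition k.
have H : \sum_j (P ^+ k) m j * h j = (-1) ^+ k * h m.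
  by apply: pow_harmonic; rewrite hh; apply/funext => i; rewrite mulN1r.
rewrite dvdn2; apply/negP => ok.
have E : \sum_j (P ^+ k) m j * (Num.sg (- h m) * h j) = `|h m|.
  under eq_bigr do rewrite mulrCA.
  rewrite -mulr_sumr H -signr_odd ok expr1 mulN1r -[in RHS]normrN.
  by rewrite normrEsg.
have C : Num.sg (- h m) * h m = `|h m|.
  apply: (convex_max_eq (Q0 m) (Q1 m) _ E) Pk => j.
  rewrite (le_trans _ (hm j isT))// (le_trans (ler_norm _))//.
  by rewrite normrM sgrN normrN normr_sg hm0 mul1r.
move: C; rewrite sgrN mulNr -normrEsg => C.
by move: hm0; rewrite -normr_gt0 -[X in 0 < X]C oppr_gt0 normr_lt0.
Qed.


(** This bounds the set of which [lambda_star] is the supremum.  Compare the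
    l^1 norms of the two sides of v P = l v. *)
Lemma eigenvalue_norm_le1 (l : R) : eigenvalue P l -> `|l| <= 1.
Proof.
case/eigenvalueP => v vP v0.
have S0 : 0 < \sum_j `|v ord0 j|.
  have [i vi] : exists i, v ord0 i != 0 by apply/rV0Pn.
  rewrite (bigD1 i)//= ltr_wpDr ?normr_gt0//.
  by apply: sumr_ge0 => j _.
rewrite -(ler_pM2r S0) mul1r mulr_sumr.
apply: (@le_trans _ _ (\sum_j \sum_i `|v ord0 i| * P i j)).
  apply: ler_sum => j _; rewrite -normrM.
  have -> : l * v ord0 j = \sum_i v ord0 i * P i j.
    by have /rowP/(_ j) := vP; rewrite !mxE.
  apply: le_trans (ler_norm_sum _ _ _) _.
  by apply: ler_sum => i _; rewrite normrM (ger0_norm (P0 i j)).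
rewrite exchange_big /=; apply: ler_sum => i _.
by rewrite -mulr_sumr P1 mulr1.
Qed.

(** [eigenvalue] refers to left eigenvectors; by reversibility, p h is one when
    h is a right eigenfunction. *)
Lemma right_eigenvalue (l : R) h : irreducible P ->
  avg h = (fun i => l * h i) -> (exists i, h i != 0) -> eigenvalue P l.
Proof.
move=> irr hl [i hi]; apply/eigenvalueP.
exists (\row_j (p j * h j)).
  apply/rowP => j; rewrite !mxE.
  have <- : \sum_i p j * (P j i * h i) = l * (p j * h j).
    rewrite -mulr_sumr mulrCA; congr (_ * _).
    by rewrite -[LHS]/(avg h j) hl.
  by apply: eq_bigr => k _; rewrite !mxE mulrA -hrev mulrAC.
apply/rV0Pn; exists i; rewrite mxE mulf_neq0//.
by rewrite gt_eqF//; exact: stationary_gt0.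
Qed.

Lemma continuous_mean : continuous (fun v : 'rV[R]_n => mean (v ord0)).
Proof.
apply: continuous_sum => i x; apply: continuousM.
  exact: cst_continuous.
exact: coord_continuous.
Qed.

Lemma continuous_dotp (u w : 'rV[R]_n -> 'I_n -> R) :
  (forall i, continuous (u ^~ i)) -> (forall i, continuous (w ^~ i)) ->
  continuous (fun v => dotp (u v) (w v)).
Proof.
move=> cu cw; apply: continuous_sum => i x.
apply: (@continuousM R _ (cst (p i)) (fun v => u v i * w v i)).
  exact: cst_continuous.
by apply: continuousM; [exact: cu|exact: cw].
Qed.

Lemma continuous_avg i : continuous (fun v : 'rV[R]_n => avg (v ord0) i).
Proof.
apply: continuous_sum => j x; apply: continuousM.
  exact: cst_continuous.
exact: coord_continuous.
Qed.

Definition unit_sphere :=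
  [set v : 'rV[R]_n | mean (v ord0) = 0 /\ dotp (v ord0) (v ord0) = 1].

Lemma unit_sphere_compact : irreducible P -> compact unit_sphere.
Proof.
move=> irr; apply: bounded_closed_compact.
  exists (\sum_j (p j)^-1 + 1); split; first exact: num_real.
  move=> x xM v [_ v1]; apply/ltW; apply: le_lt_trans xM.
  have Q0 j : 0 <= (p j)^-1 by rewrite invr_ge0.
  rewrite [leLHS]/Num.Def.normr /= mx_normrE; apply: bigmax_le => [|[i j] _ /=].
    by apply: addr_ge0 => //; apply: sumr_ge0.
  rewrite (ord1 i).
  have vj : v ord0 j ^+ 2 <= (p j)^-1.
    rewrite -(ler_pM2l (stationary_gt0 irr j)) mulfV ?gt_eqF ?stationary_gt0//.
    rewrite -v1 /dotp (bigD1 j)//= -expr2 lerDl.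
    by apply: sumr_ge0 => k _; rewrite mulr_ge0// -expr2 sqr_ge0.
  have : `|v ord0 j| <= v ord0 j ^+ 2 + 1.
    rewrite -real_normK ?num_real//; move: `|_| => y.
    by have := sqr_ge0 (y - 2^-1); nra.
  move/le_trans; apply; rewrite lerD2r (le_trans vj)//.
  by rewrite (bigD1 j)//= lerDl; apply: sumr_ge0.
rewrite (_ : unit_sphere = (fun v : 'rV[R]_n => mean (v ord0)) @^-1` [set x | x = 0]
   `&` (fun v : 'rV[R]_n => dotp (v ord0) (v ord0)) @^-1` [set x | x = 1]) //.
apply: closedI; apply: preimage_closed; try exact: closed_eq.
  by move=> v _; exact: continuous_mean.
by move=> v _; apply: continuous_dotp => i; exact: coord_continuous.
Qed.

(** The first-order condition at a zero of a nonnegative quadratic form: with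
    D > 0, a small negative e makes the expression negative. *)
Lemma psd_kernel (D b : R) : 0 <= D ->
  (forall e : R, 0 <= 2 * e * D + e ^+ 2 * b) -> D = 0.
Proof.
move=> D0 H; apply/eqP; rewrite eq_le D0 andbT leNgt; apply/negP => Dgt.
have b1 : 0 < `|b| + 1 by rewrite ltr_wpDl.
(* this e is small enough for the linear term to beat the quadratic one *)
have /(_ (- D / (`|b| + 1))) := H; rewrite leNgt => /negP; apply.
have -> : 2 * (- D / (`|b| + 1)) * D + (- D / (`|b| + 1)) ^+ 2 * b =
   (D / (`|b| + 1)) ^+ 2 * (b - 2 * (`|b| + 1)) by field; rewrite gt_eqF.
rewrite pmulr_rlt0 ?exprn_gt0 ?divr_gt0//.
by have := ler_norm b; have := normr_ge0 b; lra.
Qed.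

Lemma dotp_eq0 h : irreducible P -> dotp h h = 0 -> forall i, h i = 0.
Proof.
move=> irr h0 i.
have /psumr_eq0P/(_ h0 i isT)/eqP : forall j, true -> 0 <= p j * (h j * h j).
  by move=> j _; rewrite mulr_ge0// -expr2 sqr_ge0.
by rewrite mulf_eq0 gt_eqF ?stationary_gt0//= mulf_eq0 orbb => /eqP.
Qed.

Lemma normalize h : mean h = 0 -> 0 < dotp h h ->
  exists2 v, unit_sphere v & v ord0 = (fun i => (Num.sqrt (dotp h h))^-1 * h i).
Proof.
move=> mh h0; exists (\row_j ((Num.sqrt (dotp h h))^-1 * h j)); last first.
  by apply/funext => j; rewrite mxE.
rewrite /unit_sphere /=.
have -> : (\row_j ((Num.sqrt (dotp h h))^-1 * h j)) ord0 =
    (fun j => (Num.sqrt (dotp h h))^-1 * h j).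
  by apply/funext => j; rewrite mxE.
rewrite meanZ mh mulr0 dotpZ exprVn sqr_sqrtr ?ltW//.
by rewrite mulVf ?gt_eqF.
Qed.

(** Let mu be the maximum of |P g|^2 on the unit sphere of mean-zero functions,
    attained at g.  The first-order condition is P^2 g = mu g, that is
    (P - l) (P + l) g = 0 for l = sqrt mu, so l or - l is an eigenvalue with a
    mean-zero eigenfunction.  The maximum principles exclude the eigenvalues 1
    and -1, which gives mu < 1; and lambda_* dominates the absolute value of
    the eigenvalue found. *)
Lemma spectral_gap : irreducible P -> aperiodic P ->
  exists mu : R, [/\ 0 <= mu, mu < 1, mu <= lambda_star P ^+ 2 &
    forall h, mean h = 0 -> dotp (avg h) (avg h) <= mu * dotp h h].
Proof.
move=> irr aper.
have [[v0 Sv0]|S0] := pselect (unit_sphere !=set0); last first.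
  (* an empty sphere means that every mean-zero h vanishes *)
  exists 0; split => //; first exact: sqr_ge0.
  move=> h mh; rewrite mul0r (le_trans (dotp_avg_le h))// leNgt; apply/negP => h0.
  by apply: S0; have [v Sv _] := normalize mh h0; exists v.
have cF : continuous (fun v : 'rV[R]_n => dotp (avg (v ord0)) (avg (v ord0))).
  by apply: continuous_dotp => i; exact: continuous_avg.
have [v] := EVT_max_rV (ex_intro _ v0 Sv0) (unit_sphere_compact irr)
  (continuous_subspaceT cF).
rewrite inE => -[]; set g := v ord0 => mg g1 gmax.
set mu := dotp (avg g) (avg g) in gmax.
have mu0 : 0 <= mu by exact: dotp_ge0.
have muh h : mean h = 0 -> dotp (avg h) (avg h) <= mu * dotp h h.
  move=> mh; have [h0|h0] := eqVneq (dotp h h) 0.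
    by rewrite h0 mulr0 -[leRHS]h0 dotp_avg_le.
  have {}h0 : 0 < dotp h h by rewrite lt_def h0 dotp_ge0.
  have [w Sw wE] := normalize mh h0.
  have /gmax : w \in unit_sphere by rewrite inE.
  by rewrite wE avgZ dotpZ exprVn (sqr_sqrtr (ltW h0)) mulrC ler_pdivrMr.
have [u uE] : exists u : 'I_n -> R, u = (fun i => mu * g i + (-1) * avg (avg g) i).
  by exists (fun i => mu * g i + (-1) * avg (avg g) i).
have u_mean : mean u = 0 by rewrite uE mean_lincomb !mean_avg mg !mulr0 addr0.
have dotpu : mu * dotp g u - dotp (avg g) (avg u) = dotp u u.
  rewrite -dotp_avg /dotp mulr_sumr -sumrN -big_split/=.
  by apply: eq_bigr => i _; rewrite uE; ring.
have u0 : dotp u u = 0.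
  apply: (psd_kernel (b := mu * dotp u u - dotp (avg u) (avg u))).
    exact: dotp_ge0.
  move=> e; have := muh (fun i => 1 * g i + e * u i).
  rewrite mean_lincomb mg u_mean !mulr0 addr0 avg_lincomb !dotp_lincomb.
  move=> /(_ erefl); rewrite g1 -/mu -dotpu -subr_ge0.
  congr (_ <= _); ring.
have PPg i : avg (avg g) i = mu * g i.
  by have := dotp_eq0 irr u0 i; rewrite uE; lra.
have [l [f [l2 fl mf [i0 f0]]]] : exists l f, [/\ l ^+ 2 = mu,
    avg f = (fun i => l * f i), mean f = 0 & exists i, f i != 0].
  pose l := Num.sqrt mu; have l2 : l ^+ 2 = mu by rewrite sqr_sqrtr.
  pose h i := 1 * avg g i + l * g i.
  have [h0|/existsNP h0] := pselect (forall i, h i = 0).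
    exists (- l), g; split => //; first by rewrite sqrrN.
      by apply/funext => i; have := h0 i; rewrite /h; lra.
    apply/not_existsP => g0.
    suff : dotp g g = 0 by move/eqP; rewrite g1 oner_eq0.
    apply: big1 => i _; have /negP := g0 i; rewrite negbK => /eqP ->.
    by rewrite !mul0r mulr0.
  exists l, h; split => //.
  - rewrite avg_lincomb; apply/funext => i; rewrite /h PPg -l2; ring.
  - by rewrite mean_lincomb mean_avg mg !mulr0 addr0.
  - by case: h0 => i hi; exists i; apply/eqP.
have le1 : `|l| <= 1.
  by apply: eigenvalue_norm_le1; apply: (right_eigenvalue irr fl); exists i0.
have l1 : l != 1.
  apply: contra f0 => /eqP l1.
  have cf := @harmonic_constant f irr _ _ i0.
  have : mean f = f i0.
    rewrite /mean -[RHS]mul1r -p1 mulr_suml; apply: eq_bigr => i _.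
    by rewrite (cf _ i)// fl l1; apply/funext => j; rewrite mul1r.
  by rewrite mf => <-.
have lN1 : l != -1.
  apply: contra f0 => /eqP lE.
  rewrite (@antiharmonic_zero f aper)// fl lE.
  by apply/funext => j; rewrite mulN1r.
have ltl : l < 1.
  by rewrite lt_neqAle l1 (le_trans (ler_norm _) le1).
have gtl : -1 < l.
  by rewrite lt_neqAle eq_sym lN1; move: le1; rewrite ler_norml => /andP[].
exists mu; split => //.
  by rewrite -l2; nra.
have l_star : `|l| <= lambda_star P.
  apply: ub_le_sup.
    by exists 1 => _ [k [ek _] <-]; exact: eigenvalue_norm_le1.
  by exists l => //; split => //; apply: (right_eigenvalue irr fl); exists i0.
rewrite -l2 -real_normK ?num_real// lerXn2r ?nnegrE//.
exact: le_trans l_star.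
Qed.

End Averaging.

(** * One step of the reversed product *)

Section Products.
Context {R : realType} {m : nat}.
Local Notation n := m.+1.
Variables (P : 'M[R]_n) (p : 'I_n -> R).
Implicit Types (f g h : 'I_n -> R) (i j : 'I_n) (M : 'M[R]_n) (G : 'M[R]_n -> R).

Definition move_mx i : 'M[R]_n :=
  \matrix_(k, j) if k == i then P i j else (k == j)%:R.

Lemma potlatch_moveE i x : potlatch_move P i x = x *m move_mx i.
Proof.
apply/rowP => j; rewrite !mxE (bigD1 i)//= mxE eqxx.
case: (eqVneq j i) => [->|ji].
  by rewrite big1 ?addr0 1?mulrC// => k /negbTE ki; rewrite mxE ki mulr0.
rewrite (bigD1 j)//= mxE (negbTE ji) eqxx mulr1 big1 ?addr0.
  by rewrite addrC mulrC.
by move=> k /andP[/negbTE ki /negbTE kj]; rewrite mxE ki kj mulr0.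
Qed.

Definition column j M : 'I_n -> R := fun i => M i j.

Definition update i f : 'I_n -> R := fun l => if l == i then avg P f i else f l.

Lemma column_move i j M : column j (move_mx i *m M) = update i (column j M).
Proof.
apply/funext => l; rewrite /column /update mxE.
case: eqVneq => [->|li].
  by apply: eq_bigr => k _; rewrite mxE eqxx.
rewrite (bigD1 l)//= mxE (negbTE li) eqxx mul1r big1 ?addr0// => k kl.
by rewrite mxE (negbTE li) eq_sym (negbTE kl) mul0r.
Qed.

(** The expectation of G after one more uniformly chosen site has rung, in the
    reversed order. *)
Definition lmean G M : R := n%:R^-1 * \sum_i G (move_mx i *m M).

Lemma lmean_le G G' : (forall M, G M <= G' M) -> forall M, lmean G M <= lmean G' M.
Proof. by move=> H M; rewrite ler_wpM2l// ler_sum. Qed.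

Lemma iter_lmean_le k G G' : (forall M, G M <= G' M) ->
  forall M, iter k lmean G M <= iter k lmean G' M.
Proof. by move=> H; elim: k => // k IH M; exact: lmean_le. Qed.

Lemma lmean_lincomb (a b : R) G G' :
  lmean (fun M => a * G M + b * G' M) = (fun M => a * lmean G M + b * lmean G' M).
Proof.
apply/funext => M; rewrite /lmean big_split/= -!mulr_sumr; ring.
Qed.

Lemma iter_lmean_lincomb k (a b : R) G G' :
  iter k lmean (fun M => a * G M + b * G' M) =
  (fun M => a * iter k lmean G M + b * iter k lmean G' M).
Proof. by elim: k => //= k ->; rewrite lmean_lincomb. Qed.

Lemma lmean_cst (c : R) : lmean (fun=> c) = (fun=> c).
Proof.
apply/funext => M; rewrite /lmean sumr_const card_ord -[c *+ _]mulr_natl mulrA.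
by rewrite mulVf ?mul1r.
Qed.

Lemma iter_lmean_cst k (c : R) : iter k lmean (fun=> c) = (fun=> c).
Proof. by elim: k => //= k ->; rewrite lmean_cst. Qed.

Lemma iter_lmean_subinv (r : R) k G : 0 <= r ->
  (forall M, lmean G M <= r * G M) ->
  forall M, iter k lmean G M <= r ^+ k * G M.
Proof.
move=> r0 H; elim: k => [M|k IH M]; first by rewrite mul1r.
rewrite iterSr exprS -mulrA.
apply: le_trans (iter_lmean_le k H M) _.
have := iter_lmean_lincomb k r 0 G G.
have -> : (fun M => r * G M + 0 * G M) = (fun M => r * G M).
  by apply/funext => ?; rewrite mul0r addr0.
by move=> ->; rewrite mul0r addr0 ler_wpM2l.
Qed.

Definition var f : R := dotp p f f - mean p f ^+ 2.

Hypotheses (hP : transition_matrix P) (hp : probability_vector p).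
Hypothesis hrev : reversible P p.

Let p0 i : 0 <= p i. Proof. by case: hp. Qed.
Let p1 : \sum_i p i = 1. Proof. by case: hp. Qed.

Lemma varE f : var f = dotp p (fun i => f i - mean p f) (fun i => f i - mean p f).
Proof.
have -> : (fun i => f i - mean p f) = (fun i => 1 * f i + (- mean p f) * 1).
  by apply/funext => i; ring.
rewrite dotp_lincomb /var.
have -> : dotp p f (fun=> 1) = mean p f by apply: eq_bigr => i _; ring.
have -> : dotp p (fun=> 1) (fun=> 1) = 1.
  by rewrite /dotp; under eq_bigr do rewrite !mulr1.
ring.
Qed.

Lemma var_ge0 f : 0 <= var f.
Proof. by rewrite varE; apply: dotp_ge0. Qed.

Lemma sum_update (F : 'I_n -> R -> R) f i :
  \sum_l F l (update i f l) = \sum_l F l (f l) + (F i (avg P f i) - F i (f i)).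
Proof.
rewrite (bigD1 i)//= /update eqxx [in RHS](bigD1 i)//=.
under eq_bigr => l /negbTE -> do [].
ring.
Qed.

Lemma mean_update f i : mean p (update i f) = mean p f + p i * (avg P f i - f i).
Proof. by rewrite /mean (sum_update (fun l x => p l * x)) mulrBr. Qed.

Lemma dotp_update f i : dotp p (update i f) (update i f) =
  dotp p f f + p i * (avg P f i ^+ 2 - f i ^+ 2).
Proof. by rewrite /dotp (sum_update (fun l x => p l * (x * x))) mulrBr !expr2. Qed.

Lemma sum_mean_update f : \sum_i mean p (update i f) = n%:R * mean p f.
Proof.
under eq_bigr do rewrite mean_update mulrBr.
rewrite big_split/= sumrB sumr_const card_ord -[in LHS]mulr_natl.
by rewrite [X in _ + (X - _)](mean_avg hP hrev) subrr addr0.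
Qed.

Lemma sum_dotp_update f : \sum_i dotp p (update i f) (update i f) =
  n%:R * dotp p f f + (dotp p (avg P f) (avg P f) - dotp p f f).
Proof.
under eq_bigr do rewrite dotp_update mulrBr !expr2.
by rewrite big_split/= sumrB sumr_const card_ord -[in LHS]mulr_natl.
Qed.

(** Ringing i changes the mean by p_i ((P f)_i - f_i).  Since p is stationary,
    these changes add up to 0: the mean is a martingale. *)
Lemma lmean_mean j : lmean (fun M => mean p (column j M)) = (fun M => mean p (column j M)).
Proof.
apply/funext => M; rewrite /lmean; under eq_bigr do rewrite column_move.
by rewrite sum_mean_update mulKf.
Qed.

Lemma iter_lmean_mean k j :
  iter k lmean (fun M => mean p (column j M)) = (fun M => mean p (column j M)).
Proof. by elim: k => //= k ->; rewrite lmean_mean. Qed.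

Lemma lmean_dotp_le j M : lmean (fun M => dotp p (column j M) (column j M)) M <=
  dotp p (column j M) (column j M).
Proof.
rewrite /lmean; under eq_bigr do rewrite column_move.
rewrite sum_dotp_update mulrDr mulKf// gerDl mulr_ge0_le0// subr_le0.
exact: (dotp_avg_le hP hp hrev).
Qed.

(** Write c for the mean of the column f.  The expected square norm changes by
    (|P f|^2 - |f|^2) / n, and |P f|^2 <= c^2 + mu var f by the spectral gap
    applied to f - c; the expected square of the mean can only grow, by
    Jensen. *)
Lemma lmean_var_le (mu : R) j M :
  (forall h, mean p h = 0 -> dotp p (avg P h) (avg P h) <= mu * dotp p h h) ->
  lmean (fun M => var (column j M)) M <=
  (1 - (1 - mu) / n%:R) * var (column j M).
Proof.
move=> hmu; rewrite /lmean; under eq_bigr do rewrite column_move.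
set f := column j M.
have n0 : n%:R != 0 :> R by [].
have J : n%:R * mean p f ^+ 2 <= \sum_i mean p (update i f) ^+ 2.
  have := @jensen_sqr R 'I_n (fun=> 1) (fun i => mean p (update i f)) (fun=> ler01).
  rewrite sumr_const card_ord -(eq_bigr _ (fun i _ => esym (mul1r _))).
  rewrite -(eq_bigr _ (fun i _ => esym (mul1r _))) sum_mean_update.
  by rewrite exprMn expr2 -mulrA ler_pM2l.
have A : dotp p (avg P f) (avg P f) - mean p f ^+ 2 <= mu * var f.
  have /hmu : mean p (fun i => f i - mean p f) = 0.
    rewrite /mean; under eq_bigr do rewrite mulrBr.
    by rewrite sumrB -mulr_suml p1 mul1r subrr.
  rewrite -varE.
  have -> : avg P (fun i => f i - mean p f) = (fun i => avg P f i - mean p f).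
    apply/funext => i; rewrite /avg; under eq_bigr do rewrite mulrBr.
    by rewrite sumrB -mulr_suml; case: hP => _ ->; rewrite mul1r.
  by rewrite -(mean_avg hP hrev f) -varE.
have -> : (1 - (1 - mu) / n%:R) * var f =
   n%:R^-1 * (n%:R * var f + (mu * var f - var f)) by field.
rewrite ler_pM2l// sumrB sum_dotp_update.
move: J A; rewrite /var; set S := \sum_(_ < _) _.
lra.
Qed.

Lemma iter_lmean_var_le (mu : R) k j :
  0 <= mu -> mu < 1 ->
  (forall h, mean p h = 0 -> dotp p (avg P h) (avg P h) <= mu * dotp p h h) ->
  iter k lmean (fun M => var (column j M)) 1%:M <= (1 - (1 - mu) / n%:R) ^+ k * p j.
Proof.
move=> mu0 mu1 hmu.
have r0 : 0 <= 1 - (1 - mu) / n%:R.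
  rewrite subr_ge0 ler_pdivrMr// mul1r.
  have : (1 : R) <= n%:R by rewrite ler1n.
  lra.
apply: (le_trans (iter_lmean_subinv k r0 (fun M => lmean_var_le j M hmu) _)).
rewrite ler_wpM2l ?exprn_ge0// /var lerBlDr.
apply: (@le_trans _ _ (p j)); last by rewrite lerDl sqr_ge0.
rewrite /dotp (bigD1 j)//= big1 => [|i ij].
  by rewrite /column mxE eqxx !mulr1 addr0.
by rewrite /column mxE (negbTE ij) !mulr0.
Qed.

(** How far the columns of M are from being constant with the values that the
    column means take in a later product M'. *)
Definition dist2 M M' : R := \sum_j dotp p
  (fun i => column j M i - mean p (column j M'))
  (fun i => column j M i - mean p (column j M')).

Lemma iter_lmean_sum k (F : 'I_n -> 'M[R]_n -> R) M :
  iter k lmean (fun M => \sum_j F j M) M = \sum_j iter k lmean (F j) M.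
Proof.
elim: k M => // k IH M.
rewrite iterS /lmean; under eq_bigr do rewrite IH.
by rewrite exchange_big mulr_sumr.
Qed.

(** For a column f of M and the mean c' of the same column k steps later, the
    expectation of |f - c'|^2 is |f|^2 - 2 (mean f)^2 + E c'^2 by the martingale
    property, and E c'^2 <= |f|^2 because c'^2 is at most the square norm of the
    later column, which decreases in expectation. *)
Lemma iter_lmean_dist2_le k M :
  iter k lmean (dist2 M) M <= 2 * \sum_j var (column j M).
Proof.
rewrite iter_lmean_sum mulr_sumr; apply: ler_sum => j _.
set f := column j M.
apply: (@le_trans _ _ (iter k lmean (fun M' => 1 *
  (dotp p f f + (- 2 * mean p f) * mean p (column j M')) +
   1 * dotp p (column j M') (column j M')) M)).
  apply: iter_lmean_le => M'; rewrite !mul1r.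
  have -> : (fun i => f i - mean p (column j M')) =
     (fun i => 1 * f i + (- mean p (column j M')) * 1).
    by apply/funext => i; ring.
  rewrite dotp_lincomb.
  have -> : dotp p f (fun=> 1) = mean p f by apply: eq_bigr => i _; ring.
  have -> : dotp p (fun=> 1) (fun=> 1) = 1.
    by rewrite /dotp; under eq_bigr do rewrite !mulr1.
  have := var_ge0 (column j M'); rewrite /var.
  set x := mean p f; set y := mean p _; set z := dotp _ _ _.
  set w := dotp _ _ _. lra.
rewrite iter_lmean_lincomb !mul1r.
have -> : iter k lmean (fun M' => dotp p f f + -2 * mean p f * mean p (column j M')) M =
   dotp p f f - 2 * mean p f * mean p f.
  have E := iter_lmean_lincomb k 1 (- (2 * mean p f)) (fun=> dotp p f f)
    (fun M' => mean p (column j M')).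
  rewrite iter_lmean_cst iter_lmean_mean in E.
  transitivity (dotp p f f + - (2 * mean p f) * mean p f); last by ring.
  have := congr1 (@^~ M) E => /=; rewrite mul1r -/f => <-.
  congr (iter k _ _ _); apply/funext => M'; ring.
have H M' : lmean (fun M => dotp p (column j M) (column j M)) M' <=
   1 * dotp p (column j M') (column j M').
  by rewrite mul1r lmean_dotp_le.
have := @iter_lmean_subinv 1 k (fun M' => dotp p (column j M') (column j M')) ler01 H M.
rewrite expr1n mul1r -/f /var => Q.
set x := iter _ _ _ _ in Q |- *; rewrite expr2; lra.
Qed.

End Products.

(** * Random sites from the digits of a uniform number *)

Lemma nat_valued_measurable d (T : measurableType d) (g : T -> nat) :
  (forall c, measurable (g @^-1` [set c])) -> measurable_fun setT g.
Proof.
move=> mg _ Y _; rewrite setTI.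
rewrite (_ : g @^-1` Y = \bigcup_(c in Y) g @^-1` [set c]).
  by apply: bigcup_measurable => c _.
by apply/seteqP; split => [x Yx|x [c Yc /= ->]//]; exists (g x).
Qed.

Lemma integral_nat_valued d (T : measurableType d) (R : realType)
    (mu : {measure set T -> \bar R}) (g : T -> nat) (F : nat -> \bar R) :
  measurable_fun setT g -> (forall c, 0 <= F c)%E ->
  (\int[mu]_x F (g x) = \sum_(c <oo) F c * mu (g @^-1` [set c]))%E.
Proof.
move=> mg F0.
have mgc c : measurable (g @^-1` [set c]) by rewrite -[X in measurable X]setTI; exact: mg.
have mFg : measurable_fun setT (fun x => F (g x)).
  by move=> _ Y mY; rewrite setTI; have := mg measurableT (F @^-1` Y) I; rewrite setTI.
have TE : setT = \bigcup_c g @^-1` [set c].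
  by apply/seteqP; split => // x _; exists (g x).
rewrite [X in integral _ X _]TE ge0_integral_bigcup//=.
- apply: eq_eseriesr => c _; rewrite -integral_cst//.
  by apply: eq_integral => x; rewrite inE => /= ->.
- by rewrite -TE; exact: mFg.
- move=> i j _ _ [x /= [<- <-]] //.
Qed.

Section Digits.
Context {R : realType}.
Local Notation U := (uniform_prob (@ltr01 R)).

Lemma measurable_truncn (N : R) : measurable_fun setT (fun x : R => Num.truncn (N * x)).
Proof.
have mle c : measurable [set x : R | (Num.truncn (N * x) <= c)%N].
  rewrite (_ : [set x | _] = ( *%R N) @^-1` `]-oo, c.+1%:R[).
    by rewrite -[X in measurable X]setTI; apply: mulrl_measurable.
  by apply/seteqP; split => x /=; rewrite in_itv/= truncn_le_nat.
apply: nat_valued_measurable => -[|c].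
  rewrite (_ : _ @^-1` _ = [set x : R | (Num.truncn (N * x) <= 0)%N])//.
  by apply/seteqP; split => x /=; rewrite leqn0 => /eqP.
rewrite (_ : _ @^-1` _ = [set x : R | (Num.truncn (N * x) <= c.+1)%N] `\`
    [set x : R | (Num.truncn (N * x) <= c)%N]).
  exact: measurableD.
apply/seteqP; split => x /=.
  by move=> ->; split=> //; rewrite ltnn.
by move=> [h /negP]; rewrite -ltnNge => h'; apply/eqP; rewrite eqn_leq h.
Qed.

(** The integer part of N x is uniform on the integers below N; it equals N
    only at the null point x = 1. *)
Lemma digit_law (N c : nat) : (0 < N)%N ->
  U [set x | Num.truncn (N%:R * x) = c] = (if (c < N)%N then N%:R^-1 else 0)%:E.
Proof.
move=> N0; have N0' : 0 < N%:R :> R by rewrite ltr0n.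
rewrite /uniform_prob integral_uniform_pdf.
have pdf1 (x : R) : x \in `[0, 1]%classic -> uniform_pdf 0 1 x = 1.
  by rewrite inE/= in_itv/= /uniform_pdf => ->; rewrite subr0 invr1.
rewrite (eq_integral (cst 1%E)); last first.
  by move=> x; rewrite inE => -[_ /= xI]; rewrite pdf1 ?inE.
have mD : measurable ([set x : R | Num.truncn (N%:R * x) = c] `&` `[0, 1]).
  apply: measurableI => //.
  have := @measurable_truncn N%:R measurableT [set c] I.
  by rewrite setTI.
rewrite integral_cst// mul1e.
have tE (x : R) : 0 <= x -> (Num.truncn (N%:R * x) = c) <->
    (c%:R / N%:R <= x < c.+1%:R / N%:R).
  move=> x0; rewrite ler_pdivrMr// ltr_pdivlMr// ![x * _]mulrC.
  rewrite -truncn_eq ?mulr_ge0// 1?ltW//.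
  by split => [/eqP|/eqP].
case: ifPn => cN.
  rewrite (_ : _ `&` _ = `[c%:R / N%:R, c.+1%:R / N%:R[%classic).
    rewrite [LHS](lebesgue_measure_itv `[c%:R / N%:R, c.+1%:R / N%:R[)/= lte_fin ltr_pM2r
      ?invr_gt0// ltr_nat ltnSn.
    by rewrite -EFinB -mulrBl -natrB// subSnn mul1r.
  apply/seteqP; split => x /=; rewrite !in_itv/=.
    by move=> [h /andP[x0 _]]; apply/tE.
  move=> /andP[h1 h2].
  have x0 : 0 <= x by rewrite (le_trans _ h1)// divr_ge0.
  split; first by apply/tE => //; rewrite h1.
  rewrite x0 (le_trans (ltW h2))// ler_pdivrMr// mul1r ler_nat//.
rewrite -leqNgt in cN.
apply/eqP; rewrite eq_le measure_ge0 andbT.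
rewrite (@le_trans _ _ (lebesgue_measure [set (1 : R)]))//; last first.
  by rewrite lebesgue_measure_set1.
apply: le_measure; rewrite ?inE//.
move=> x /= [h]; rewrite in_itv/= => /andP[x0 x1].
apply/eqP; rewrite eq_le x1/=; move/tE : h => /(_ x0) /andP[h _].
by rewrite (le_trans _ h)// ler_pdivlMr// mul1r ler_nat.
Qed.

Lemma integral_digit (N : nat) (F : nat -> \bar R) : (0 < N)%N ->
  (forall c, 0 <= F c)%E ->
  (\int[U]_x F (Num.truncn (N%:R * x)) = N%:R^-1%:E * \sum_(c < N) F c)%E.
Proof.
move=> N0 F0.
have /= -> := integral_nat_valued U (measurable_truncn N%:R) F0.
rewrite (nneseries_split 0 N); last by move=> *; rewrite mule_ge0.
rewrite eseries0 ?adde0; last first.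
  move=> c; rewrite add0n => Nc _.
  by rewrite [X in (_ * X)%E]digit_law// ltnNge Nc mule0.
rewrite add0n big_mkord ge0_sume_distrr//.
by apply: eq_bigr => c _; rewrite [X in (_ * X)%E]digit_law// ltn_ord muleC.
Qed.

(** For x = a^k u, this drops the last of the first k + 1 base a digits of u. *)
Lemma truncn_divn (a : nat) (x : R) : (0 < a)%N ->
  (Num.truncn (a%:R * x) %/ a)%N = Num.truncn x.
Proof.
move=> a0; have le_all q : (q <= Num.truncn (a%:R * x) %/ a)%N = (q <= Num.truncn x)%N.
  case: q => // q.
  rewrite leq_divRL// -[in LHS](prednK (n := q.+1 * a)) ?muln_gt0//.
  rewrite !truncn_gt_nat prednK ?muln_gt0// natrM mulrC ler_pM2l ?ltr0n//.
by apply/eqP; rewrite eqn_leq -le_all leqnn le_all leqnn.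
Qed.

End Digits.

Section BackProduct.
Context {R : realType} {m : nat}.
Local Notation n := m.+1.
Local Notation U := (uniform_prob (@ltr01 R)).
Variable (P : 'M[R]_n).

(** The reversed product read off k base n digits of c.  The last digit is the
    site that rings last, which is the leftmost factor. *)
Fixpoint back_prod (k c : nat) : 'M[R]_n :=
  if k is k'.+1 then move_mx P (inord (c %% n)) *m back_prod k' (c %/ n)
  else 1%:M.

(** Averaging over the last digit is one [lmean] step, with the first k digits
    kept fixed. *)
Lemma sum_back_prod k r (H : 'M[R]_n -> 'M[R]_n -> R) :
  (n ^ (k + r))%:R^-1 * \sum_(c < n ^ (k + r)) H (back_prod k (c %/ n ^ r)) (back_prod (k + r) c) =
  (n ^ k)%:R^-1 * \sum_(c < n ^ k) iter r (lmean P) (H (back_prod k c)) (back_prod k c).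
Proof.
elim: r H => [|r IH] H.
  by rewrite addn0; congr (_ * _); apply: eq_bigr => c _; rewrite expn0 divn1.
under [in RHS]eq_bigr do rewrite iterSr.
rewrite -(IH (fun M => lmean P (H M))) addnS expnSr natrM invfM -mulrA; congr (_ * _).
rewrite -(big_mkord xpredT (fun c => H (back_prod k (c %/ n ^ r.+1)) (back_prod (k + r).+1 c))).
rewrite big_nat_mul big_mkord mulr_sumr; apply: eq_bigr => q _.
rewrite /lmean; congr (_ * _).
rewrite -{1}[(q * n)%N]add0n big_addn mulSn addnK big_mkord.
apply: eq_bigr => i _ /=.
have E : ((i + q * n) %/ n = q)%N by rewrite addnC divnMDl// divn_small ?addn0.
have -> : ((i + q * n) %/ n ^ r.+1 = q %/ n ^ r)%N by rewrite expnS divnMA E.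
have E2 : ((i + q * n) %% n = i)%N by rewrite addnC modnMDl modn_small.
by rewrite E E2 inord_val.
Qed.

Lemma sum_back_prod1 k (G : 'M[R]_n -> R) :
  (n ^ k)%:R^-1 * \sum_(c < n ^ k) G (back_prod k c) = iter k (lmean P) G 1%:M.
Proof.
have := sum_back_prod 0 k (fun _ => G).
by rewrite add0n => ->; rewrite expn0 invr1 mul1r big_ord1.
Qed.

(** For every k the first k digits of x are used, so one x drives the whole
    sequence of products. *)
Definition rand_prod k (x : R) := back_prod k (Num.truncn ((n ^ k)%:R * x)).

Lemma rand_prodE k r x :
  rand_prod k x = back_prod k (Num.truncn ((n ^ (k + r))%:R * x) %/ n ^ r).
Proof.
have -> : (n ^ (k + r))%:R * x = (n ^ r)%:R * ((n ^ k)%:R * x).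
  by rewrite expnD natrM mulrA [X in X * x]mulrC.
by rewrite /rand_prod truncn_divn// expn_gt0.
Qed.

Lemma integral_rand_prod2 k r (H : 'M[R]_n -> 'M[R]_n -> R) :
  (forall M M', 0 <= H M M') ->
  (\int[U]_x (H (rand_prod k x) (rand_prod (k + r) x))%:E =
  (iter k (lmean P) (fun M => iter r (lmean P) (H M) M) 1%:M)%:E)%E.
Proof.
move=> H0; under eq_integral do rewrite (rand_prodE k r) /rand_prod.
rewrite (@integral_digit _ _ (fun c => (H (back_prod k (c %/ n ^ r)) (back_prod (k + r) c))%:E));
  [|by rewrite expn_gt0|by move=> c; rewrite lee_fin].
rewrite sumEFin -EFinM sum_back_prod.
by rewrite (sum_back_prod1 k (fun M => iter r (lmean P) (H M) M)).
Qed.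

Lemma integral_rand_prod k (G : 'M[R]_n -> R) : (forall M, 0 <= G M) ->
  (\int[U]_x (G (rand_prod k x))%:E = (iter k (lmean P) G 1%:M)%:E)%E.
Proof. by move=> G0; rewrite -(integral_rand_prod2 k 0 (H := fun M _ => G M)). Qed.

Lemma measurable_rand_prod k (G : 'M[R]_n -> R) :
  measurable_fun setT (fun x => G (rand_prod k x)).
Proof.
rewrite (_ : (fun x => _) = (fun c => G (back_prod k c)) \o
  (fun x : R => Num.truncn ((n ^ k)%:R * x)))//.
exact: measurableT_comp (measurable_truncn _).
Qed.

Lemma measurable_rand_prod2 k r (H : 'M[R]_n -> 'M[R]_n -> R) :
  measurable_fun setT (fun x => H (rand_prod k x) (rand_prod (k + r) x)).
Proof.
pose F c := H (back_prod k (c %/ n ^ r)) (back_prod (k + r) c).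
rewrite (_ : (fun x => _) = F \o (fun x : R => Num.truncn ((n ^ (k + r))%:R * x))).
  exact: measurableT_comp (measurable_truncn _).
by apply/funext => x; rewrite (rand_prodE k r).
Qed.

End BackProduct.

(** * Almost sure convergence of the reversed products *)

(** The sum of the g k has a finite integral, so it is finite almost everywhere
    and its terms tend to 0. *)
Lemma ae_cvg0_of_geometric d (T : measurableType d) (R : realType)
    (mu : {measure set T -> \bar R}) (g : nat -> T -> R) (C r : R) :
  0 <= r -> r < 1 ->
  (forall k, measurable_fun setT (g k)) -> (forall k x, 0 <= g k x) ->
  (forall k, \int[mu]_x (g k x)%:E <= (C * r ^+ k)%:E)%E ->
  {ae mu, forall x, g k x @[k --> \oo] --> 0}.
Proof.
move=> r0 r1 mg g0 gC.
have C0 : 0 <= C.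
  have := gC 0%N; rewrite expr0 mulr1 -lee_fin => /(le_trans _); apply.
  by apply: integral_ge0 => x _; rewrite lee_fin.
have mS : measurable_fun setT (fun x => (\sum_(k <oo) (g k x)%:E)%E).
  apply: ge0_emeasurable_sum => [k x _ _|k _]; first by rewrite lee_fin.
  by apply/measurable_EFinP.
have S_lty : (\int[mu]_x (\sum_(k <oo) (g k x)%:E) < +oo)%E.
  rewrite integral_nneseries//; last 2 first.
    by move=> k; apply/measurable_EFinP.
    by move=> k x _; rewrite lee_fin.
  apply: (@le_lt_trans _ _ (C / (1 - r))%:E); last by rewrite ltry.
  apply: lime_le.
    by apply: is_cvg_nneseries => k _ _; apply: integral_ge0 => x _; rewrite lee_fin.
  apply: nearW => N.
  apply: (@le_trans _ _ (\sum_(0 <= k < N) (C * r ^+ k)%:E)%E).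
    by apply: lee_sum => k _; exact: gC.
  rewrite sumEFin lee_fin.
  have := @geometric_seriesE R C r; rewrite lt_eqF// => /(_ isT)/(congr1 (@^~ N)).
  rewrite /series/= => ->.
  rewrite ler_pM2r ?invr_gt0 ?subr_gt0// ler_piMr// gerBl.
  by rewrite exprn_ge0.
have : mu.-integrable setT (fun x => (\sum_(k <oo) (g k x)%:E)%E).
  apply/integrableP; split => //.
  rewrite (eq_integral (fun x => (\sum_(k <oo) (g k x)%:E)%E)) => [//|x _].
  by rewrite gee0_abs// nneseries_ge0// => k _ _; rewrite lee_fin.
move/(integrable_ae measurableT); apply: filterS => x /(_ I) xfin.
apply: cvg_series_cvg_0; apply: nnseries_is_cvg => [k|]; first exact: g0.
by rewrite ltey_eq xfin.
Qed.

Section Limit.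
Context {R : realType} {m : nat}.
Local Notation n := m.+1.
Local Notation U := (uniform_prob (@ltr01 R)).
Variables (P : 'M[R]_n) (p : 'I_n -> R) (mu : R).
Hypotheses (hP : transition_matrix P) (hp : probability_vector p).
Hypotheses (hrev : reversible P p) (p_gt0 : forall i, 0 < p i).
Hypotheses (mu0 : 0 <= mu) (mu1 : mu < 1).
Hypothesis hmu : forall h, mean p h = 0 ->
  dotp p (avg P h) (avg P h) <= mu * dotp p h h.
Implicit Types (M : 'M[R]_n) (i j : 'I_n).

Let rho := 1 - (1 - mu) / n%:R.

Lemma rho_ge0 : 0 <= rho.
Proof.
rewrite subr_ge0 ler_pdivrMr// mul1r.
have : (1 : R) <= n%:R by rewrite ler1n.
by move: mu0; lra.
Qed.

Lemma rho_lt1 : rho < 1.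
Proof. by rewrite ltrBlDr ltrDl divr_gt0// subr_gt0. Qed.

Let p0 i : 0 <= p i. Proof. by case: hp. Qed.
Let p1 : \sum_i p i = 1. Proof. by case: hp. Qed.

Lemma move_mx_transition i M : transition_matrix M -> transition_matrix (move_mx P i *m M).
Proof.
have [P0 P1] := hP.
move=> [M0 M1]; split=> [k l|k].
  rewrite mxE; apply: sumr_ge0 => j _; rewrite mulr_ge0// mxE.
  by case: ifP => // _; rewrite ler0n.
under eq_bigr do rewrite mxE.
rewrite exchange_big/=; under eq_bigr do rewrite -mulr_sumr M1 mulr1 mxE.
have [ki|ki] := eqVneq k i; first exact: P1.
rewrite (bigD1 k)//= eqxx big1 ?addr0// => j /negbTE jk.
by rewrite eq_sym jk.
Qed.

Lemma rand_prod_transition k x : transition_matrix (rand_prod P k x).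
Proof.
rewrite /rand_prod; elim: k (Num.truncn _) => [|k IH] c /=; last first.
  exact: move_mx_transition.
split=> [i j|i]; first by rewrite mxE ler0n.
rewrite (bigD1 i)//= mxE eqxx big1 ?addr0// => j /negbTE ji.
by rewrite mxE eq_sym ji.
Qed.

Lemma transition_le1 M i j : transition_matrix M -> M i j <= 1.
Proof.
move=> [M0 M1]; rewrite -(M1 i) (bigD1 j)//= lerDl.
by apply: sumr_ge0.
Qed.

(** The default value 1 is neutral: the entries of a transition matrix are at
    most 1. *)
Definition col_min j M : R := \big[Num.min/1]_i M i j.

Lemma col_min_le j M i : col_min j M <= M i j.
Proof. exact: bigmin_le_cond. Qed.

Lemma col_min_move i j M : col_min j M <= col_min j (move_mx P i *m M).
Proof.
apply: le_bigmin => [|l _]; first by exact: bigmin_le_id.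
rewrite -/(column j (move_mx P i *m M) l) column_move /update.
case: ifP => _; last exact: col_min_le.
have [P0 P1] := hP.
rewrite -[leLHS]mul1r -(P1 i) mulr_suml; apply: ler_sum => k _.
by rewrite ler_wpM2l// col_min_le.
Qed.

Lemma rand_prodS k x : exists i, rand_prod P k.+1 x = move_mx P i *m rand_prod P k x.
Proof.
rewrite (rand_prodE P k 1) addn1 expn1; eexists; reflexivity.
Qed.

Lemma col_min_nondecreasing j x :
  nondecreasing_seq (fun k => col_min j (rand_prod P k x)).
Proof.
apply/nondecreasing_seqP => k.
by have [i ->] := rand_prodS k x; exact: col_min_move.
Qed.

(** The minimum of a column is nondecreasing along the products, so this limit
    exists for every x; where the columns become constant it is the common limit
    of their entries. *)
Definition limit_row (x : R) j : R := lim (col_min j (rand_prod P k x) @[k --> \oo]).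

Lemma limit_row_cvg x j : col_min j (rand_prod P k x) @[k --> \oo] --> limit_row x j.
Proof.
apply: (nondecreasing_is_cvgn (col_min_nondecreasing j x)).
by exists 1 => _ [k _ <-]; exact: bigmin_le_id.
Qed.

Lemma measurable_limit_row j : measurable_fun setT (limit_row ^~ j).
Proof.
apply: (@measurable_fun_cvg _ _ _ _ (fun k x => col_min j (rand_prod P k x))).
  by move=> k; exact: measurable_rand_prod.
by move=> x _; exact: limit_row_cvg.
Qed.

Lemma entry_mean_le i j M :
  (M i j - mean p (column j M)) ^+ 2 <= (\sum_l (p l)^-1) * var p (column j M).
Proof.
rewrite (varE hp); set S := dotp _ _ _.
have pS : p i * (M i j - mean p (column j M)) ^+ 2 <= S.
  rewrite /S /dotp (bigD1 i)//= -expr2 lerDl.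
  by apply: sumr_ge0 => l _; rewrite -expr2 mulr_ge0// sqr_ge0.
have S0 : 0 <= S by rewrite (le_trans _ pS)// mulr_ge0// sqr_ge0.
apply: (@le_trans _ _ ((p i)^-1 * S)).
  by rewrite ler_pdivlMl.
rewrite ler_wpM2r// (bigD1 i)//= lerDl; apply: sumr_ge0 => l _.
by rewrite invr_ge0.
Qed.

Lemma mean_le1 j M : transition_matrix M -> mean p (column j M) <= 1.
Proof.
move=> hM; rewrite -p1; apply: ler_sum => i _.
by rewrite ler_piMr// transition_le1.
Qed.

(** All the entries of a column are within s of its mean, where s^2 is the
    variance times the sum of the 1 / p_l; so are its entries and its minimum
    within 2 s of each other. *)
Lemma col_min_close i j M : transition_matrix M ->
  `|M i j - col_min j M| <=
    2 * Num.sqrt ((\sum_l (p l)^-1) * var p (column j M)).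
Proof.
move=> hM; set s := Num.sqrt _; set c := mean p (column j M).
have s0 : 0 <= s by exact: sqrtr_ge0.
have Mc l : `|M l j - c| <= s.
  by rewrite -sqrtr_sqr ler_wsqrtr// entry_mean_le.
have lo : c - s <= col_min j M.
  apply: le_bigmin => [|l _]; last by have := Mc l; rewrite ler_distl => /andP[].
  by rewrite lerBlDr (le_trans (mean_le1 j hM))// lerDl.
have up := col_min_le j M i.
rewrite ger0_norm ?subr_ge0//.
by have := Mc i; rewrite ler_distl => /andP[_]; lra.
Qed.

Lemma rand_prod_var_le k j :
  (\int[U]_x (var p (column j (rand_prod P k x)))%:E <= (rho ^+ k * p j)%:E)%E.
Proof.
rewrite (integral_rand_prod P k (G := fun M => var p (column j M))).
  by rewrite lee_fin (iter_lmean_var_le hP hp hrev).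
by move=> M; exact: var_ge0.
Qed.

Lemma rand_prod_cvg :
  {ae U, forall x, forall i j, rand_prod P k x i j @[k --> \oo] --> limit_row x j}.
Proof.
have := @ae_cvg0_of_geometric _ _ R U
  (fun k x => \sum_j var p (column j (rand_prod P k x))) (\sum_j p j) rho
  rho_ge0 rho_lt1.
have h1 k : measurable_fun setT (fun x => \sum_j var p (column j (rand_prod P k x))).
  exact: (measurable_rand_prod P k (fun M => \sum_j var p (column j M))).
have v0 j M : 0 <= var p (column j M) by exact: var_ge0.
have h2 k x : 0 <= \sum_j var p (column j (rand_prod P k x)).
  by apply: sumr_ge0.
move=> /(_ h1 h2) h; have {h} : {ae U, forall x, \sum_j var p (column j (rand_prod P k x))
  @[k --> \oo] --> 0}.
  apply: h => k; under eq_integral do rewrite -sumEFin.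
  rewrite ge0_integral_sum//; last 2 first.
    by move=> j; apply/measurable_EFinP; exact:
      (measurable_rand_prod P k (fun M => var p (column j M))).
    by move=> j x _; rewrite lee_fin.
  rewrite mulrC mulr_sumr -sumEFin; apply: lee_sum => j _.
  exact: rand_prod_var_le.
apply: filterS; first exact: (ae_filter_ringOfSetsType U).
move=> x vcvg i j.
have vj : var p (column j (rand_prod P k x)) @[k --> \oo] --> 0.
  apply: (squeeze_cvgr _ (@cvg_cst _ 0 _ _ _) vcvg).
  by apply: nearW => k; rewrite v0/= (bigD1 j)//= lerDl; apply: sumr_ge0.
set S := \sum_l (p l)^-1.
have sj : 2 * Num.sqrt (S * var p (column j (rand_prod P k x))) @[k --> \oo] --> 0.
  have c1 : S * var p (column j (rand_prod P k x)) @[k --> \oo] --> S * 0.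
    exact: (@cvgM R _ \oo _ (cst S) _ _ _ (cvg_cst S) vj).
  have c2 : Num.sqrt (S * var p (column j (rand_prod P k x))) @[k --> \oo] --> Num.sqrt (S * 0).
    exact: (cvg_comp _ _ c1 (@sqrt_continuous R (S * 0))).
  rewrite mulr0 sqrtr0 in c2.
  have c3 := @cvgM R _ \oo _ (cst 2) _ _ _ (cvg_cst (2 : R)) c2.
  by rewrite mulr0 in c3; exact: c3.
have dj : rand_prod P k x i j - col_min j (rand_prod P k x) @[k --> \oo] --> 0.
  apply: norm_cvg0; apply: (squeeze_cvgr _ (@cvg_cst _ 0 _ _ _) sj).
  by apply: nearW => k; rewrite normr_ge0/= col_min_close//; exact: rand_prod_transition.
rewrite -[X in _ --> X]add0r.
rewrite (_ : (fun k => _) = (fun k => (rand_prod P k x i j - col_min j (rand_prod P k x)) +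
  col_min j (rand_prod P k x))).
  by apply: cvgD => //; exact: limit_row_cvg.
by apply/funext => k; rewrite subrK.
Qed.

Definition limit_dist2 M (y : 'I_n -> R) : R := \sum_j dotp p
  (fun i => M i j - y j) (fun i => M i j - y j).

Lemma limit_dist2_ge0 M y : 0 <= limit_dist2 M y.
Proof. by apply: sumr_ge0 => j _; exact: dotp_ge0. Qed.

Lemma measurable_limit_dist2 k :
  measurable_fun setT (fun x => limit_dist2 (rand_prod P k x) (limit_row x)).
Proof.
apply: measurable_sum => j; apply: measurable_sum => i.
have mf : measurable_fun setT (fun x => rand_prod P k x i j - limit_row x j).
  apply: measurable_funB; last exact: measurable_limit_row.
  exact: (measurable_rand_prod P k (fun M => M i j)).
by apply: measurable_funM => //; exact: measurable_funM.
Qed.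

Lemma limit_dist2_cvg k x :
  (forall i j, rand_prod P l x i j @[l --> \oo] --> limit_row x j) ->
  dist2 p (rand_prod P k x) (rand_prod P (k + r) x) @[r --> \oo] -->
    limit_dist2 (rand_prod P k x) (limit_row x).
Proof.
move=> cv.
have cm j : mean p (column j (rand_prod P (k + r) x)) @[r --> \oo] --> limit_row x j.
  have cj i : p i * rand_prod P (k + r) x i j @[r --> \oo] --> p i * limit_row x j.
    apply: (@cvgM R _ \oo _ (cst (p i)) _ _ _ (cvg_cst (p i))).
    exact: (cvg_comp _ _ (@cvg_addnl k) (cv i j)).
  rewrite -[limit_row x j]mul1r -p1 mulr_suml.
  by apply: cvg_big => [|i _]; [exact: add_continuous|exact: cj].
apply: cvg_big => [|j _]; first exact: add_continuous.
apply: cvg_big => [|i _]; first exact: add_continuous.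
have cd : column j (rand_prod P k x) i - mean p (column j (rand_prod P (k + r) x)) @[r --> \oo]
   --> rand_prod P k x i j - limit_row x j.
  by apply: cvgB => //; exact: cvg_cst.
by apply: cvgM; [exact: cvg_cst|exact: cvgM].
Qed.

(** The means of later columns converge to the limits, so Fatou's lemma carries
    the bound of [iter_lmean_dist2_le] over to the limit.  At time 0 the
    variances of the columns of the identity add up to at most 1, the sum of the
    p_j. *)
Lemma integral_limit_dist2_le k :
  (\int[U]_x (limit_dist2 (rand_prod P k x) (limit_row x))%:E <= (2 * rho ^+ k)%:E)%E.
Proof.
pose f r x := (dist2 p (rand_prod P k x) (rand_prod P (k + r) x))%:E.
have d0 M M' : 0 <= dist2 p M M' by apply: sumr_ge0 => j _; exact: dotp_ge0.
have mf r : measurable_fun setT (f r).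
  apply/measurable_EFinP.
  exact: (measurable_rand_prod2 P k r (dist2 p)).
have f0 r x : (0 <= f r x)%E by rewrite lee_fin.
apply: (@le_trans _ _ (\int[U]_x limn_einf (f ^~ x))%E).
  apply: ae_ge0_le_integral => //.
  - by move=> x _; rewrite lee_fin limit_dist2_ge0.
  - by apply/measurable_EFinP; exact: measurable_limit_dist2.
  - move=> x _; rewrite limn_einf_lim; apply: lime_ge; first exact: is_cvg_einfs.
    by apply: nearW => r; apply: le_ereal_inf_tmp => _ [l _ <-]; exact: f0.
  - rewrite (_ : (fun x => _) = (fun x => - limn_esup (fun r => - f r x))%E).
      apply: measurableT_comp => //; apply: measurable_fun_limn_esup => r.
      by apply: measurableT_comp => //; exact: mf.
    apply/funext => x; have := limn_esupN (f ^~ x).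
    by rewrite /comp => ->; rewrite oppeK.
  have := rand_prod_cvg; apply: filterS; first exact: (ae_filter_ringOfSetsType U).
  move=> x cv _.
  have h : f r x @[r --> \oo] --> (limit_dist2 (rand_prod P k x) (limit_row x))%:E.
    by apply: cvg_EFin; [exact: nearW|exact: limit_dist2_cvg].
  by have [-> _] := cvg_limn_einf_sup h.
have h := fatou U measurableT mf (fun r x _ => f0 r x).
apply: (le_trans h); rewrite limn_einf_lim; apply: lime_le.
  exact: is_cvg_einfs.
apply: nearW => r.
apply: (@le_trans _ _ (\int[U]_x f r x)%E).
  by apply: ereal_inf_lbound; exists r => /=.
rewrite (integral_rand_prod2 P k r (H := dist2 p))// lee_fin.
apply: (@le_trans _ _ (iter k (lmean P) (fun M => \sum_j 2 * var p (column j M)) 1%:M)).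
  apply: iter_lmean_le => M; rewrite -mulr_sumr.
  exact: (iter_lmean_dist2_le hP hp hrev).
rewrite (iter_lmean_sum P k (fun j M => 2 * var p (column j M))).
have -> : 2 * rho ^+ k = \sum_j 2 * rho ^+ k * p j by rewrite -mulr_sumr p1 mulr1.
apply: ler_sum => j _ /=.
have := iter_lmean_lincomb P k 2 0 (fun M => var p (column j M)) (fun=> 0).
rewrite (_ : (fun M => 2 * var p (column j M) + 0 * 0) = (fun M => 2 * var p (column j M))).
  by move=> ->; rewrite mul0r addr0 -mulrA ler_pM2l// (iter_lmean_var_le hP hp hrev).
by apply/funext => M; rewrite mul0r addr0.
Qed.

End Limit.

(** * Borel sets of row vectors *)

Section Vectors.
Context {R : realType} {n : nat}.

Lemma continuous_measurable_rV (f : 'rV[R]_n -> R) :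
  continuous f -> measurable_fun setT (f : borelRV R n -> R).
Proof.
move=> cf; apply: (measurability _ (RGenOpens.measurableE R)).
move=> _ [_ [a [b ->]] <-]; rewrite setTI; apply: sub_sigma_algebra.
by apply: open_comp; [move=> x _; exact: cf|exact: interval_open].
Qed.

Lemma measurable_coord (j : 'I_n) :
  measurable_fun setT (fun v : borelRV R n => (v : 'rV[R]_n) ord0 j).
Proof. by apply: continuous_measurable_rV; exact: coord_continuous. Qed.

(** An open set is a countable union of boxes with rational centres and radii
    1 / (k + 1), and a box is a finite intersection of conditions on the
    coordinates. *)
Lemma measurable_rowP d (T : measurableType d) (f : T -> borelRV R n) :
  (forall j, measurable_fun setT (fun w => (f w : 'rV[R]_n) ord0 j)) ->
  measurable_fun setT f.
Proof.
move=> mf; apply: (@measurability _ _ T (borelRV R n) setT f (@open 'rV[R]_n)) => // _ [V oV <-].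
rewrite setTI.
pose box (c : 'rV[rat]_n * nat) : set 'rV[R]_n :=
  [set v | forall j, `|v ord0 j - ratr (c.1 ord0 j)| < c.2.+1%:R^-1].
rewrite (_ : f @^-1` V = \bigcup_k
   (if unpickle k is Some c then (if `[< box c `<=` V >] then f @^-1` box c else set0) else set0)).
  apply: bigcup_measurable => k _; case: unpickle => // c.
  case: ifP => // _.
  rewrite (_ : f @^-1` box c = \bigcap_(j in [set: 'I_n])
     (fun w => (f w : 'rV[R]_n) ord0 j) @^-1` ball (ratr (c.1 ord0 j) : R) c.2.+1%:R^-1).
    apply: fin_bigcap_measurable => // j _.
    rewrite -[X in measurable X]setTI; apply: mf => //.
    exact: measurable_ball.
  apply/seteqP; split => w /=.
    by move=> h j _; rewrite /= /ball /= distrC; exact: h.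
  by move=> h j; have := h j I; rewrite /= /ball /= distrC.
apply/seteqP; split => w /=; last first.
  move=> [k _]; case: unpickle => // c; case: ifP => // /asboolP bV; exact: bV.
move=> Vf.
have /nbhs_ballP[e /= e0 eV] : nbhs (f w : 'rV[R]_n) V by exact: open_nbhs_nbhs.
have [k ke] : exists k, 2 * k.+1%:R^-1 < e :> R.
  exists (Num.truncn (2 / e)).
  rewrite -ltr_pdivlMl// invf_plt ?posrE ?divr_gt0 ?mulr_gt0 ?invr_gt0//.
  by rewrite invfM invrK mulrC; exact: truncnS_gt.
have [q qP] : exists q : 'I_n -> rat, forall j,
    `|(f w : 'rV[R]_n) ord0 j - ratr (q j)| < k.+1%:R^-1.
  suff h j : exists q : rat, `|(f w : 'rV[R]_n) ord0 j - ratr q| < k.+1%:R^-1.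
    by have [q hq] := choice h; exists q.
  pose y : R := (f w : 'rV[R]_n) ord0 j; rewrite -/y.
  have : y - k.+1%:R^-1 < y + k.+1%:R^-1.
    by rewrite ltrD2l gtrN// invr_gt0.
  move=> /rat_in_itvoo[q]; rewrite in_itv/= => /andP[h1 h2]; exists q.
  by rewrite distrC ltr_distl h1 h2.
exists (pickle (\row_j q j, k)) => //; rewrite pickleK.
case: asboolP => [_|]; first by move=> j; rewrite mxE; exact: qP.
case => v /= hv; apply: eV; split => // i j; rewrite (ord1 i).
have := hv j; rewrite mxE => h1; have h2 := qP j.
rewrite /ball /=; move: h1 h2 ke; move: k.+1%:R^-1 (ratr (q j)) => r z.
rewrite !ltr_distl => /andP[? ?] /andP[? ?] ?.
by apply/andP; split; lra.
Qed.

End Vectors.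

(** * Paths between two grid times *)

Section Paths.
Context {R : realType} {n : nat}.
Variables (P : 'M[R]_n) (F : 'I_n -> R -> nat) (x : R -> 'rV[R]_n).

(** [rings] on a single path. *)
Definition jumps_at (f : R -> nat) (t : R) :=
  0 < t /\ forall s, 0 <= s -> s < t -> (f s < f t)%N.

Hypothesis F_mono : forall i (s t : R), 0 <= s -> s <= t -> (F i s <= F i t)%N.
Hypothesis F_right : forall i (t : R), 0 <= t -> \forall s \near t^'+, F i s = F i t.
Hypothesis x_jump : forall i t, jumps_at (F i) t ->
  x t = potlatch_move P i (lim (x s @[s --> t^'-])).
Hypothesis x_const : forall s t : R, 0 <= s -> s <= t ->
  (forall i r, s < r -> r <= t -> ~ jumps_at (F i) r) -> x t = x s.

Lemma no_jump i (s t r : R) : 0 <= s -> s < r -> r <= t ->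
  F i t = F i s -> ~ jumps_at (F i) r.
Proof.
move=> s0 sr rt E [_ /(_ s s0 sr)]; rewrite -E ltnNge F_mono//.
by rewrite (le_trans s0)// ltW.
Qed.

Lemma no_ring_step (s t : R) : 0 <= s -> s <= t ->
  (forall i, F i t = F i s) -> x t = x s.
Proof. by move=> s0 st E; apply: x_const => // i r sr rt; exact: (no_jump s0 sr rt). Qed.

(** A right-continuous path that increases by exactly 1 does so at one time r,
    the infimum of the times at which it has increased. *)
Lemma jump_time i (s t : R) : 0 <= s -> s < t -> F i t = (F i s).+1 ->
  exists r, [/\ s < r, r <= t, forall u, s <= u -> u < r -> F i u = F i s &
    F i r = F i t].
Proof.
move=> s0 st E.
pose A := [set u | s <= u <= t /\ (F i s < F i u)%N].
have At : A t by split; [rewrite lexx ltW|rewrite E].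
have lA : lbound A s by move=> u [/andP[]].
have iA : has_inf A by split; [exists t|exists s].
pose r := inf A.
have sr : s <= r by apply: lb_le_inf => //; exists t.
have rt : r <= t by apply: ge_inf => //; exists s.
have r0 : 0 <= r by exact: le_trans sr.
have Fr : (F i s < F i r)%N.
  have [e /= e0 Fe] := F_right i r0.
  have [u Au ur] := inf_adherent e0 iA.
  have ru : r <= u by apply: ge_inf => //; exists s.
  case: Au => su Fu; move: ru; rewrite le_eqVlt => /orP[/eqP ->//|ru].
  rewrite -(Fe u)//= /ball_/= distrC gtr0_norm ?subr_gt0//.
  by rewrite ltrBlDl.
exists r; split => //.
- rewrite lt_neqAle sr andbT; apply/eqP => rs.
  by move: Fr; rewrite -rs ltnn.
- move=> u su ur; apply/eqP; rewrite eq_sym eqn_leq F_mono//=.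
  rewrite leqNgt; apply/negP => Fu.
  have : r <= u.
    by apply: ge_inf; [exists s|split => //; rewrite su (le_trans (ltW ur))].
  by rewrite leNgt ur.
- by apply/eqP; rewrite eqn_leq F_mono//= E.
Qed.

(** The state is constant before and after the jump time r of clock i, so its
    left limit at r is x s and its value at r is x t. *)
Lemma one_ring_step i (s t : R) : 0 <= s -> s < t -> F i t = (F i s).+1 ->
  (forall j, j != i -> F j t = F j s) -> x t = potlatch_move P i (x s).
Proof.
move=> s0 st E Ej.
have [r [sr rt before atr]] := jump_time s0 st E.
have r0 : 0 < r by exact: le_lt_trans sr.
have jr : jumps_at (F i) r.
  split => // u u0 ur; rewrite atr E ltnS.
  have [su|us] := leP s u; first by rewrite before.
  by rewrite F_mono// ltW.
have Fjr j : j != i -> F j r = F j s.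
  move=> ji; apply/eqP; rewrite eqn_leq -{1}(Ej j ji) !F_mono//; exact: ltW.
have -> : x t = x r.
  apply: no_ring_step => //; first exact: ltW.
  by move=> j; have [->|ji] := eqVneq j i; rewrite ?atr// Fjr// Ej.
rewrite (x_jump jr); congr potlatch_move.
apply: lim_near_cst => //.
exists (r - s); first by rewrite /= subr_gt0.
move=> u /=; rewrite distrC => us ur.
have su : s < u.
  by move: us; rewrite distrC gtr0_norm ?subr_gt0//; lra.
apply: no_ring_step => //; first exact: ltW.
move=> j; have [->|ji] := eqVneq j i; first by rewrite before// ltW.
apply/eqP; rewrite eqn_leq -{1}(Fjr j ji) !F_mono//; try exact: ltW.
by apply: le_trans (ltW su).
Qed.

End Paths.

(** * Words of rings and the order of multiplication *)

Section Words.
Context {R : realType} {m : nat}.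
Local Notation n := m.+1.
Variable P : 'M[R]_n.
Implicit Types (V : 'M[R]_n -> R) (M : 'M[R]_n).

(** The counterpart of [lmean] for the order in which the process multiplies. *)
Definition rmean V M : R := n%:R^-1 * \sum_i V (M *m move_mx P i).

(** Left and right multiplications commute. *)
Lemma lmean_rmean V M : lmean P (rmean V) M = rmean (lmean P V) M.
Proof.
rewrite /lmean /rmean -!mulr_sumr; congr (_ * (_ * _)).
rewrite exchange_big; apply: eq_bigr => i _; apply: eq_bigr => j _.
by rewrite mulmxA.
Qed.

(** The two operators commute and agree at the identity matrix, so right steps
    can be exchanged for left steps one at a time: reversing a product of
    independent uniform factors does not change its law. *)
Lemma iter_rmean_lmean k V : iter k rmean V 1%:M = iter k (lmean P) V 1%:M.
Proof.
elim: k V => // k IH V.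
rewrite iterS iterSr -IH.
have -> W : rmean W 1%:M = lmean P W 1%:M.
  by rewrite /rmean /lmean; congr (_ * _); apply: eq_bigr => i _; rewrite mul1mx mulmx1.
elim: k {IH} V => // k IH V.
rewrite [in LHS]iterSr IH [in RHS]iterSr; congr (iter k rmean _ _).
by apply/funext => M; exact: lmean_rmean.
Qed.

(** What happens on one interval of the grid: [None] is no ring, [Some i] a
    single ring of clock i. *)
Definition letter_mx (o : option 'I_n) : 'M[R]_n :=
  if o is Some i then move_mx P i else 1%:M.

(** The binomial formula for the commuting operators 1 and a [rmean]. *)
Lemma iter_one_plus (a : R) V K M :
  iter K (fun W M => W M + a * rmean W M) V M =
  \sum_(k < K.+1) 'C(K, k)%:R * a ^+ k * iter k rmean V M.
Proof.
elim: K M => [|K IH] M.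
  by rewrite big_ord1 bin0 expr0 !mul1r.
rewrite iterS IH.
have -> : rmean (iter K (fun W M => W M + a * rmean W M) V) M =
  \sum_(k < K.+1) 'C(K, k)%:R * a ^+ k * iter k.+1 rmean V M.
  rewrite {1}/rmean; under eq_bigr do rewrite IH.
  rewrite exchange_big mulr_sumr; apply: eq_bigr => k _.
  by rewrite -mulr_sumr mulrCA.
rewrite mulr_sumr [in RHS]big_ord_recl.
under [in RHS]eq_bigr => k _ do rewrite lift0 binS natrD 2!mulrDl.
rewrite [in RHS]big_split/= addrA; congr (_ + _).
  rewrite big_ord_recl !bin0 big_ord_recr/= bin_small// !mul0r addr0.
  by congr (_ + _).
by apply: eq_bigr => k _; rewrite exprS; ring.
Qed.

Lemma sum_tuple_cons (T : finType) K (G : seq T -> R) :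
  \sum_(c : K.+1.-tuple T) G c = \sum_o \sum_(c : K.-tuple T) G (o :: c).
Proof.
rewrite pair_bigA/=.
rewrite (reindex (fun z : T * K.-tuple T => [tuple of z.1 :: z.2]))//=.
exists (fun c : K.+1.-tuple T => (thead c, [tuple of behead c])).
  by move=> [ o c ] _ /=; congr pair; apply: val_inj.
by move=> c _ /=; rewrite [in RHS](tuple_eta c).
Qed.

Lemma sum_option (T : finType) (G : option T -> R) :
  \sum_o G o = G None + \sum_i G (Some i).
Proof.
rewrite (bigD1 None)//=; congr (_ + _).
rewrite (reindex_omap Some id); last by case.
by apply: eq_bigl => i; rewrite eqxx.
Qed.

Lemma sum_words (q s : R) V K M :
  \sum_(c : K.-tuple (option 'I_n))
    (\prod_(o <- c) (q * (if o is Some _ then s else 1))) *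
     V (foldl (fun M o => M *m letter_mx o) M c) =
  q ^+ K * iter K (fun W M => W M + (s * n%:R) * rmean W M) V M.
Proof.
elim: K M => [|K IH] M.
  rewrite (big_pred1 [tuple]) => [|c]; last by rewrite [c]tuple0.
  by rewrite big_nil expr0.
rewrite (sum_tuple_cons K (fun c : seq _ => (\prod_(o <- c) (q * (if o is Some _ then s else 1))) *
     V (foldl (fun M o => M *m letter_mx o) M c))).
under eq_bigr => o _.
  under eq_bigr => c _ do rewrite big_cons /= -mulrA.
  rewrite -mulr_sumr IH; over.
rewrite sum_option/= mulr1 mulmx1 exprS.
under eq_bigr do rewrite -mulrA.
rewrite -!mulr_sumr.
set W := iter K _ V.
have -> : \sum_i W (M *m move_mx P i) = n%:R * rmean W M by rewrite mulVKf.
ring.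
Qed.

End Words.

(** * Probabilities of words of rings *)

Section GridEvents.
Context {d : measure_display} {T : measurableType d} {R : realType}.
Context {Pr : probability T R} {m : nat}.
Local Notation n := m.+1.
Variables (N : 'I_n -> R -> {RV Pr >-> nat}) (X0 : {RV Pr >-> borelRV R n}).
Hypothesis hN : clocks N X0.
Variables (delta : R) (delta_gt0 : 0 < delta).

Let grid (k : nat) : R := k%:R * delta.

Let grid_ge0 k : 0 <= grid k.
Proof. by rewrite mulr_ge0// ltW. Qed.

(** Increments are functions of two values of the process; this is what makes
    the independence of the clocks apply to them. *)
Lemma sigma_process_incr i (s t : R) (k : nat) : 0 <= s -> 0 <= t ->
  sigma_process (N i) [set w | incr (N i) s t w = k].
Proof.
move=> s0 t0.
pose G := \bigcup_(u in `[0, +oo[) sigma_rv (N i u : T -> nat).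
have mN (u : R) a : 0 <= u -> (@measurable _ (g_sigma_algebraType G)) [set w | N i u w = a].
  move=> u0; apply: sub_sigma_algebra; exists u; first by rewrite /= in_itv/= u0.
  by exists [set a] => //; rewrite setTI.
rewrite (_ : [set w | _] = \bigcup_a \bigcup_b (if (b - a == k)%N then
   [set w | N i s w = a] `&` [set w | N i t w = b] else set0)).
  suff : (@measurable _ (g_sigma_algebraType G)) (\bigcup_a \bigcup_b (if (b - a == k)%N then
   [set w | N i s w = a] `&` [set w | N i t w = b] else set0)) by [].
  apply: bigcup_measurable => a _; apply: bigcup_measurable => b _.
  by case: ifP => // _; apply: measurableI; exact: mN.
apply/seteqP; split => w /=.
  by rewrite /incr => <-; exists (N i s w) => //; exists (N i t w) => //; rewrite eqxx.
by move=> [a _ [b _]]; case: ifP => // /eqP <- [<- <-].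
Qed.

Lemma sigma_process_measurable i A : sigma_process (N i) A -> measurable A.
Proof.
apply: smallest_sub; first exact: sigma_algebra_measurable.
by move=> B [u _ [C mC <-]]; apply: (measurable_funP (N i u)).
Qed.

(** What the word c prescribes for clock i; the coercion from [bool] asks for
    one ring on the intervals of letter [Some i] and none on the others. *)
Definition site_event (c : seq (option 'I_n)) i : set T :=
  \bigcap_(k in [set` iota 0 (size c)])
    [set w | incr (N i) (grid k) (grid k.+1) w = (nth None c k == Some i)].

Definition word_event (c : seq (option 'I_n)) : set T :=
  \bigcap_(i in [set` enum 'I_n]) site_event c i.

Lemma sigma_process_site_event c i : sigma_process (N i) (site_event c i).
Proof.
pose G := \bigcup_(u in `[0, +oo[) sigma_rv (N i u : T -> nat).
suff : (@measurable _ (g_sigma_algebraType G)) (site_event c i) by [].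
apply: fin_bigcap_measurable => // k _.
exact: sigma_process_incr.
Qed.

Lemma measurable_word_event c : measurable (word_event c).
Proof.
apply: fin_bigcap_measurable => // i _.
by apply: sigma_process_measurable; exact: sigma_process_site_event.
Qed.

Lemma prob_site_event c i : Pr (site_event c i) =
  (\prod_(o <- c) (if o == Some i then delta * expR (- delta) else expR (- delta)))%:E.
Proof.
have [hpois _] := hN.
have grid_homo : {homo grid : k l / (k <= l)%N >-> k <= l}.
  by move=> k l kl; rewrite ler_pM2r// ler_nat.
rewrite /site_event
  (poisson_independent_increments (hpois i) (grid_ge0 0%N) grid_homo (iota_uniq _ _)); last first.
  by move=> k _; exists [set (nth None c k == Some i : nat)] => //; rewrite setTI.
rewrite (eq_bigr (fun k => (poisson_pmf delta (nth None c k == Some i))%:E)); last first.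
  move=> k _; have -> : delta = grid k.+1 - grid k.
    by rewrite -mulrBl -natrB// subSnn mul1r.
  apply: (poisson_increment (hpois i)) => //.
  by rewrite ltr_pM2r// ltr_nat.
rewrite prodEFin; congr EFin; rewrite (big_nth None) /index_iota subn0.
apply: eq_bigr => k _; rewrite /poisson_pmf delta_gt0.
by case: eqP => _; rewrite ?expr1 ?expr0 ?fact0 ?invr1 ?mulr1 ?mul1r.
Qed.

(** n clocks are observed on an interval of length delta: each of them
    contributes exp(- delta), and the one that rings a factor delta. *)
Definition letter_weight (o : option 'I_n) : R :=
  expR (- delta) ^+ n * (if o is Some _ then delta else 1).

Lemma prod_site_weight (c : seq (option 'I_n)) :
  \prod_(i < n) \prod_(o <- c) (if o == Some i then delta * expR (- delta) else expR (- delta)) =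
  \prod_(o <- c) letter_weight o.
Proof.
rewrite exchange_big; apply: eq_bigr => o _; rewrite /letter_weight.
case: o => [j|]; last first.
  by rewrite prodr_const card_ord mulr1.
rewrite (eq_bigr (fun i => expR (- delta) * (if i == j then delta else 1))).
  rewrite big_split/= prodr_const card_ord; congr (_ * _).
  by rewrite (bigD1 j)//= eqxx big1 ?mulr1// => i /negbTE ->.
move=> i _; rewrite (_ : (Some j == Some i) = (i == j)); last by rewrite eq_sym.
by case: ifP; rewrite ?mulr1 1?mulrC.
Qed.

(** Independence of X(0) and the clocks, then independence of the increments
    of each clock. *)
Lemma prob_word_event c (B : set (borelRV R n)) : measurable B ->
  Pr ((X0 @^-1` B) `&` word_event c) =
  (Pr (X0 @^-1` B) * (\prod_(o <- c) letter_weight o)%:E)%E.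
Proof.
move=> mB; have [_ hind] := hN.
pose A (o : option 'I_n) := if o is Some i then site_event c i else X0 @^-1` B.
pose J := None :: [seq Some i | i <- enum 'I_n].
have uJ : uniq J.
  rewrite /= map_inj_uniq ?enum_uniq ?andbT; last by move=> ? ? [].
  by apply/negP => /mapP[].
have -> : (X0 @^-1` B) `&` word_event c = \bigcap_(o in [set` J]) A o.
  rewrite bigcap_seq /J big_cons big_map -bigcap_seq//.
rewrite (hind J A uJ); last first.
  move=> [i|] _ /=; first exact: sigma_process_site_event.
  by exists B => //; rewrite setTI.
rewrite /J big_cons big_map; congr (_ * _)%E.
under eq_bigr do rewrite prob_site_event.
by rewrite prodEFin big_enum/= prod_site_weight.
Qed.

Lemma trivIset_word_event K :
  trivIset [set: K.-tuple (option 'I_n)] (fun c => word_event c).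
Proof.
move=> c c' _ _ [w [/= cw c'w]]; apply: val_inj => /=.
apply: (@eq_from_nth _ None); first by rewrite !size_tuple.
move=> k; rewrite size_tuple => kK.
have E i : (nth None c k == Some i) = (nth None c' k == Some i).
  have := cw i; have := c'w i; rewrite /= mem_enum => /(_ isT) h' /(_ isT) h.
  have := h k; have := h' k; rewrite /= !mem_iota !size_tuple add0n kK /=.
  by move=> /(_ isT) -> /(_ isT); do 2 case: eqP => _.
case ck : (nth None c k) => [i|].
  by have := E i; rewrite ck eqxx => /esym/eqP.
by case c'k : (nth None c' k) => [i|//]; have := E i; rewrite ck c'k eqxx.
Qed.

End GridEvents.

(** * The law of the process at a fixed time *)

Lemma measurable_mulmxr (R : realType) (n : nat) (M : 'M[R]_n) :
  measurable_fun setT (fun v : borelRV R n => ((v : 'rV[R]_n) *m M : borelRV R n)).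
Proof.
apply: measurable_rowP => j.
rewrite (_ : (fun w => _) = (fun v : borelRV R n => \sum_k (v : 'rV[R]_n) ord0 k * M k j)).
  apply: measurable_sum => k; apply: measurable_funM; last exact: measurable_cst.
  exact: measurable_coord.
by apply/funext => v; rewrite mxE.
Qed.

(** Induction on k: consecutive binomial terms differ by the factor
    (K + 1 - k) / (k + 1) * x / (K + 1), which tends to x / (k + 1). *)
Lemma binom_cvg (R : realType) (x : R) k :
  'C(K.+1, k)%:R * (x / K.+1%:R) ^+ k @[K --> \oo] --> x ^+ k / k`!%:R.
Proof.
elim: k => [|k IH].
  rewrite expr0 fact0 divr1 (_ : (fun K => _) = fun=> 1); first exact: cvg_cst.
  by apply/funext => K; rewrite bin0 expr0 mulr1.
have c1 : (K.+1 - k)%N%:R / K.+1%:R @[K --> \oo] --> (1 : R).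
  apply: (@cvg_trans _ (1 - k%:R * K.+1%:R^-1 @[K --> \oo])).
    apply: near_eq_cvg; near=> K.
    have kK : (k <= K.+1)%N by apply: leqW; near: K; exact: nbhs_infty_ge.
    by rewrite natrB// mulrBl mulfV.
  have c0 : k%:R * K.+1%:R^-1 @[K --> \oo] --> (k%:R * 0 : R).
    exact: (@cvgM R _ \oo _ (cst k%:R) _ _ _ (cvg_cst _) cvg_harmonic).
  rewrite mulr0 in c0.
  have c1 : 1 - k%:R * K.+1%:R^-1 @[K --> \oo] --> (1 - 0 : R).
    by apply: cvgB => //; exact: cvg_cst.
  by rewrite subr0 in c1.
have c2 : x / k.+1%:R * ('C(K.+1, k)%:R * (x / K.+1%:R) ^+ k *
    ((K.+1 - k)%N%:R / K.+1%:R)) @[K --> \oo] --> x / k.+1%:R * (x ^+ k / k`!%:R * 1).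
  exact: (@cvgM R _ \oo _ (cst (x / k.+1%:R)) _ _ _ (cvg_cst _) (cvgM IH c1)).
rewrite (_ : x ^+ k.+1 / (k.+1)`!%:R = x / k.+1%:R * (x ^+ k / k`!%:R * 1)); last first.
  by rewrite factS natrM exprS invfM; ring.
apply: cvg_trans c2; apply: near_eq_cvg; apply: nearW => K /=.
have E : 'C(K.+1, k.+1)%:R = (K.+1 - k)%N%:R * 'C(K.+1, k)%:R / k.+1%:R :> R.
  by apply: (mulIf (x := k.+1%:R)) => //; rewrite divfK// -!natrM mulnC mul_bin_left.
rewrite E exprS; ring.
Unshelve. all: by end_near. Qed.

Lemma ae_le_measure d (T : measurableType d) (R : realType)
    (mu : {measure set T -> \bar R}) (A B : set T) :
  measurable A -> measurable B -> {ae mu, forall w, A w -> B w} ->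
  (mu A <= mu B)%E.
Proof.
move=> mA mB [Z [mZ Z0 sZ]].
rewrite -(measureU0 mB mZ Z0); apply: le_measure; rewrite ?inE//.
  exact: measurableU.
move=> w Aw; have [Bw|nBw] := pselect (B w); first by left.
by right; apply: sZ => /= h; apply: nBw; exact: h.
Qed.

Section Law.
Context {d : measure_display} {T : measurableType d} {R : realType}.
Context {Pr : probability T R} {m : nat}.
Local Notation n := m.+1.
Variables (P : 'M[R]_n) (N : 'I_n -> R -> {RV Pr >-> nat}).
Variable (X : R -> {RV Pr >-> borelRV R n}).
Hypothesis hX : potlatch_process P N X.

Definition word_mx (c : seq (option 'I_n)) : 'M[R]_n :=
  foldl (fun M o => M *m letter_mx P o) 1%:M c.

(** Almost surely all paths are regular; then the word is read letter by letter,
    with [no_ring_step] and [one_ring_step]. *)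
Lemma ae_word_event (delta : R) : 0 < delta ->
  {ae Pr, forall w, forall c : seq (option 'I_n), word_event N delta c w ->
     X ((size c)%:R * delta) w = (X 0 w : 'rV[R]_n) *m word_mx c}.
Proof.
move=> delta0.
have [hpois _] := potlatch_clocks hX.
have h3 : {ae Pr, forall w, forall i,
    (forall s t : R, 0 <= s -> s <= t -> (N i s w <= N i t w)%N) /\
    (forall t : R, 0 <= t -> \forall s \near t^'+, N i s w = N i t w)}.
  by apply: filter_forall => i; exact: (poisson_paths (hpois i)).
move: (potlatch_ring hX) (potlatch_constant hX) h3.
apply: filterS3 => w hring hconst hpath.
pose F i t := N i t w.
pose x t : 'rV[R]_n := X t w.
have Fm i (s t : R) : 0 <= s -> s <= t -> (F i s <= F i t)%N by case: (hpath i) => + _; apply.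
have Fr i (t : R) : 0 <= t -> \forall s \near t^'+, F i s = F i t by case: (hpath i) => _; apply.
elim/last_ind => [_|c o IH hc].
  by rewrite /= mul0r mulmx1.
have hk k i : (k <= size c)%N -> incr (N i) (k%:R * delta) (k.+1%:R * delta) w =
    (nth None (rcons c o) k == Some i).
  move=> kc; have := hc i; rewrite /= mem_enum => /(_ isT) h.
  by have := h k; rewrite /= mem_iota size_rcons add0n ltnS kc; apply.
have {IH}IH : x ((size c)%:R * delta) = x 0 *m word_mx c.
  apply: IH => i /= _ k /=; rewrite mem_iota add0n /= => kc.
  by rewrite hk ?(ltnW kc)// nth_rcons kc.
have s0 : 0 <= (size c)%:R * delta by rewrite mulr_ge0// ltW.
have st : (size c)%:R * delta < (size c).+1%:R * delta by rewrite ltr_pM2r// ltr_nat.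
have hF i : subn (F i ((size c).+1%:R * delta)) (F i ((size c)%:R * delta)) = (o == Some i).
  by have := hk _ i (leqnn _); rewrite nth_rcons ltnn eqxx.
have hF0 i : o != Some i -> F i ((size c).+1%:R * delta) = F i ((size c)%:R * delta).
  move=> /negbTE oi; have := hF i; rewrite oi => /eqP; rewrite subn_eq0 => h.
  by apply/eqP; rewrite eqn_leq h Fm// ltW.
rewrite size_rcons /word_mx -cats1 foldl_cat /= mulmxA -/(word_mx c).
rewrite -[X 0 w *m word_mx c]/(x 0 *m word_mx c) -IH.
case: o hc hk hF hF0 => [i|] _ _ hF hF0 /=; last first.
  rewrite mulmx1.
  exact: (no_ring_step Fm hconst s0 (ltW st) (fun i => hF0 i isT)).
rewrite -potlatch_moveE.
apply: (one_ring_step Fm Fr hring hconst s0 st).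
  have := hF i; rewrite eqxx => h.
  by rewrite -(subnKC (Fm i _ _ s0 (ltW st))) h addn1.
by move=> j ji; apply: hF0; apply: contra ji => /eqP[->].
Qed.

Definition initial_prob (A : set (borelRV R n)) (M : 'M[R]_n) : R :=
  fine (Pr (X 0 @^-1` ((fun v : borelRV R n => (v : 'rV[R]_n) *m M : borelRV R n) @^-1` A))).

Lemma measurable_mulmx_preimage A M : measurable A ->
  measurable ((fun v : borelRV R n => (v : 'rV[R]_n) *m M : borelRV R n) @^-1` A).
Proof.
by move=> mA; rewrite -[X in measurable X]setTI; exact: measurable_mulmxr.
Qed.

Lemma measurable_initial A M : measurable A -> measurable
  (X 0 @^-1` ((fun v : borelRV R n => (v : 'rV[R]_n) *m M : borelRV R n) @^-1` A)).
Proof.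
move=> mA; rewrite -[X in measurable X]setTI; apply: measurable_funP => //.
exact: measurable_mulmx_preimage.
Qed.

Lemma initial_probE A M : measurable A ->
  (initial_prob A M)%:E =
  Pr (X 0 @^-1` ((fun v : borelRV R n => (v : 'rV[R]_n) *m M : borelRV R n) @^-1` A)).
Proof. by move=> mA; rewrite fineK// fin_num_measure//; exact: measurable_initial. Qed.

Lemma initial_prob_ge0 A M : 0 <= initial_prob A M.
Proof. exact: fine_ge0. Qed.

(** The word events are disjoint, and on each of them X(t) is the prescribed
    product applied to X(0), almost surely. *)
Lemma sum_word_events_le (t : R) (K : nat) (A : set (borelRV R n)) :
  0 < t -> (0 < K)%N -> measurable A ->
  \sum_(c : K.-tuple (option 'I_n))
    (\prod_(o <- c) letter_weight (t / K%:R) o) * initial_prob A (word_mx c) <=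
  fine (Pr (X t @^-1` A)).
Proof.
move=> t0 K0 mA; set delta := t / K%:R.
have d0 : 0 < delta by rewrite divr_gt0// ltr0n.
have hN := potlatch_clocks hX.
pose B (c : K.-tuple (option 'I_n)) : set T :=
  (X 0 @^-1` ((fun v : borelRV R n => (v : 'rV[R]_n) *m word_mx c : borelRV R n) @^-1` A)) `&`
  word_event N delta c.
have mB c : measurable (B c).
  by apply: measurableI; [exact: measurable_initial|exact: measurable_word_event].
have mXA : measurable (X t @^-1` A).
  by rewrite -[X in measurable X]setTI; exact: measurable_funP.
rewrite -lee_fin fineK ?fin_num_measure//.
have -> : (\sum_(c : K.-tuple (option 'I_n))
    (\prod_(o <- c) letter_weight delta o) * initial_prob A (word_mx c))%:E =
  (\sum_(c : K.-tuple (option 'I_n)) Pr (B c))%E.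
  rewrite -sumEFin; apply: eq_bigr => c _.
  rewrite /B (prob_word_event hN d0); last exact: measurable_mulmx_preimage.
  by rewrite EFinM initial_probE// muleC.
have -> : (\sum_(c : K.-tuple (option 'I_n)) Pr (B c))%E = Pr (\bigcup_c B c).
  rewrite measure_fin_bigcup//.
    rewrite (_ : [set: K.-tuple (option 'I_n)] = [set` enum {: K.-tuple (option 'I_n)}]).
      by rewrite -fsbig_seq ?enum_uniq// big_enum.
    by apply/seteqP; split => // c _ /=; rewrite mem_enum.
    exact: finite_finset.
  move=> c c' _ _ [w [[_ cw] [_ c'w]]].
  by apply: (@trivIset_word_event _ _ _ _ _ N delta K) => //; exists w.
apply: ae_le_measure => //.
  by apply: fin_bigcup_measurable => //; exact: finite_finset.
have := ae_word_event d0; apply: filterS => w hw [c _ [/= Aw cw]].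
have <- : (size c)%:R * delta = t.
  by rewrite size_tuple /delta mulrC divfK// pnatr_eq0 -lt0n.
by rewrite (hw c cw).
Qed.

(** On a grid of K + 1 intervals the previous bound is a binomial mixture, which
    tends to the Poisson mixture term by term. *)
Lemma poisson_sum_le (t : R) (L : nat) (A : set (borelRV R n)) :
  0 < t -> measurable A ->
  \sum_(k < L) poisson_pmf (n%:R * t) k * iter k (lmean P) (initial_prob A) 1%:M <=
  fine (Pr (X t @^-1` A)).
Proof.
move=> t0 mA; set x := n%:R * t; set a := fun k => iter k (lmean P) (initial_prob A) 1%:M.
have x0 : 0 < x by rewrite mulr_gt0.
have a0 k : 0 <= a k.
  have := @iter_lmean_le _ _ P k (fun=> 0) (initial_prob A) (initial_prob_ge0 A) 1%:M.
  by rewrite iter_lmean_cst.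
have cvgu : expR (- x) * \sum_(k < L) 'C(K.+1, k)%:R * (x / K.+1%:R) ^+ k * a k
    @[K --> \oo] --> expR (- x) * \sum_(k < L) x ^+ k / k`!%:R * a k.
  apply: (@cvgM R _ \oo _ (cst (expR (- x))) _ _ _ (cvg_cst _)).
  apply: cvg_big => [|k _]; first exact: add_continuous.
  by apply: cvgM; [exact: binom_cvg|exact: cvg_cst].
rewrite (_ : \sum_(k < L) _ = expR (- x) * \sum_(k < L) x ^+ k / k`!%:R * a k); last first.
  rewrite mulr_sumr; apply: eq_bigr => k _; rewrite /poisson_pmf x0.
  by rewrite mulrCA mulrA mulrC mulrA [a k * _]mulrC.
apply: (cvgr_to_le cvgu); near=> K.
have LK : (L <= K.+2)%N by apply: leqW; apply: leqW; near: K; exact: nbhs_infty_ge.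
apply: le_trans (sum_word_events_le (K := K.+1) t0 isT mA).
rewrite /letter_weight sum_words.
have -> : t / K.+1%:R * n%:R = x / K.+1%:R by rewrite /x; ring.
have -> : (expR (- (t / K.+1%:R)) ^+ n) ^+ K.+1 = expR (- x).
  rewrite -exprM -expRM_natl; congr expR.
  by rewrite /x natrM; field.
rewrite ler_pM2l ?expR_gt0// iter_one_plus (big_ord_widen _
  (fun k => 'C(K.+1, k)%:R * (x / K.+1%:R) ^+ k * a k) LK).
rewrite [leLHS]big_mkcond/=; apply: ler_sum => k _.
rewrite iter_rmean_lmean; case: ifP => // _.
apply: mulr_ge0; last exact: a0.
by apply: mulr_ge0 => //; rewrite exprn_ge0// divr_ge0// ltW.
Unshelve. all: by end_near. Qed.

End Law.

(** * Products of probabilities and Poisson sums *)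

Section ProductLemmas.
Context {R : realType}.

Definition prod_prob d1 d2 (T1 : measurableType d1) (T2 : measurableType d2)
    (P1 : probability T1 R) (P2 : probability T2 R) : probability (T1 * T2)%type R :=
  (P1 \x P2)%E.

Lemma prod_prob_ysection d1 d2 (T1 : measurableType d1) (T2 : measurableType d2)
    (P1 : probability T1 R) (P2 : probability T2 R) (A : set (T1 * T2)) :
  measurable A -> (prod_prob P1 P2 A = \int[P2]_y P1 (ysection A y))%E.
Proof.
move=> mA; have E B C : measurable B -> measurable C ->
    ((P1 \x^ P2) (B `*` C) = P1 B * P2 C)%E by exact: product_measure2E.
exact: (product_measure_unique E mA).
Qed.

Lemma prod_prob_setXT d1 d2 (T1 : measurableType d1) (T2 : measurableType d2)
    (P1 : probability T1 R) (P2 : probability T2 R) (A : set T1) :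
  measurable A -> prod_prob P1 P2 (A `*` setT) = P1 A.
Proof.
move=> mA; rewrite -[RHS]mule1 -(probability_setT P2).
exact: product_measure1E.
Qed.

Section IntegralProdProb.
Context d1 d2 (T1 : measurableType d1) (T2 : measurableType d2).
Variables (P1 : probability T1 R) (P2 : probability T2 R) (f : T1 * T2 -> \bar R).
Hypotheses (mf : measurable_fun setT f) (f0 : forall z, (0 <= f z)%E).

Lemma integral_prod_prob :
  (\int[prod_prob P1 P2]_z f z = \int[P2]_y \int[P1]_x f (x, y))%E.
Proof. exact: fubini_tonelli2. Qed.

Lemma measurable_inner_integral :
  measurable_fun setT (fun y => (\int[P1]_x f (x, y))%E).
Proof. exact: (measurable_fun_fubini_tonelli_G (m1 := P1)). Qed.

End IntegralProdProb.

Lemma measurable_nat_sections d1 d2 (T1 : measurableType d1) (T2 : measurableType d2)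
    (f : T1 * nat -> T2) :
  (forall k, measurable_fun setT (fun x => f (x, k))) -> measurable_fun setT f.
Proof.
move=> mf _ A mA; rewrite setTI.
rewrite (_ : f @^-1` A = \bigcup_k (((fun x => f (x, k)) @^-1` A) `*` [set k])).
  apply: bigcup_measurable => k _; apply: measurableX => //.
  by rewrite -[X in measurable X]setTI; exact: mf.
apply/seteqP; split => [[x k] /= Af|[x k] [l _ [/= Af ->]]//].
by exists k.
Qed.

Definition poisson_law (x : R) : probability nat R := poisson_prob x 0.

Definition unif01 : probability (measurableTypeR R) R := uniform_prob (@ltr01 R).

Lemma poisson_law_gt0 (x : R) k : 0 < x ->
  poisson_law x [set k] = (poisson_pmf x k)%:E.
Proof.
move=> x0; rewrite /poisson_law/= /poisson_prob x0 esum_set1//.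
by rewrite lee_fin poisson_pmf_ge0.
Qed.

Lemma poisson_law0 k : poisson_law 0 [set k] = ((k == 0)%N%:R : R)%:E.
Proof.
rewrite /poisson_law/= /poisson_prob ltxx /dirac indicE.
by congr (_%:R)%:E; congr nat_of_bool; apply/idP/eqP => [|->]; rewrite inE//= => ->.
Qed.

(** The generating function of the Poisson law; at rate 0 the law is a Dirac
    mass. *)
Lemma poisson_geometric_le (x r : R) : 0 <= x -> 0 <= r ->
  (\sum_(k <oo) (r ^+ k)%:E * poisson_law x [set k] <= (expR (- (x * (1 - r))))%:E)%E.
Proof.
move=> x0 r0; apply: lime_le.
  by apply: is_cvg_nneseries => k _ _; rewrite mule_ge0// lee_fin exprn_ge0.
apply: nearW => L.
move: x0; rewrite le_eqVlt => /orP[/eqP <-|x0].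
  under eq_bigr do rewrite poisson_law0 -EFinM.
  rewrite sumEFin lee_fin mul0r oppr0 expR0.
  case: L => [|L]; first by rewrite big_nil.
  rewrite big_nat_recl// expr0 mulr1 big1 ?addr0// => k _.
  by rewrite mulr0.
under eq_bigr do rewrite poisson_law_gt0// -EFinM.
rewrite sumEFin lee_fin.
have -> : - (x * (1 - r)) = - x + x * r by ring.
rewrite expRD.
have -> : \sum_(0 <= k < L) r ^+ k * poisson_pmf x k =
    expR (- x) * series (exp_coeff (x * r)) L.
  rewrite /series/= mulr_sumr; apply: eq_bigr => k _.
  by rewrite /poisson_pmf x0 /exp_coeff/= exprMn; ring.
rewrite ler_pM2l ?expR_gt0//.
have -> : expR (x * r) = limn (series (exp_coeff (x * r))) by [].
apply: nondecreasing_cvgn_le; last exact: is_cvg_series_exp_coeff.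
apply/nondecreasing_seqP => k; rewrite seriesSr lerDl.
by rewrite /exp_coeff /= divr_ge0// exprn_ge0// mulr_ge0// ltW.
Qed.

(** From exp y >= y^(k+1) / (k+1)!, the mass of k is at most (k + 1) / y at
    rate y. *)
Lemma poisson_law_cvg0 (k : nat) (c : R) : 0 < c ->
  fine (poisson_law (c * t) [set k]) @[t --> +oo] --> 0.
Proof.
move=> c0.
have inv0 : t^-1 @[t --> +oo] --> (0 : R).
  have pos : \forall t \near +oo, 0 < (id : R -> R) t by exact: nbhs_pinfty_gt.
  by apply/(gtr0_cvgV0 pos); exact: cvg_id.
have h : (k.+1%:R / c) * t^-1 @[t --> +oo] --> (0 : R).
  rewrite -(mulr0 (k.+1%:R / c)).
  exact: (@cvgM R _ _ _ (cst (k.+1%:R / c)) _ _ _ (cvg_cst _) inv0).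
apply: (squeeze_cvgr _ (@cvg_cst _ (0 : R) _ _ _) h).
near=> t.
have t0 : 0 < t by near: t; exact: nbhs_pinfty_gt.
have ct0 : 0 < c * t by rewrite mulr_gt0.
rewrite poisson_law_gt0//= poisson_pmf_ge0/= /poisson_pmf ct0.
have -> : (k.+1%:R / c) * t^-1 = k.+1%:R / (c * t) by rewrite invfM mulrA.
rewrite ler_pdivlMr// expRN.
rewrite mulrAC ler_pdivrMr ?expR_gt0// mulrAC -exprSr.
rewrite ler_pdivrMr ?ltr0n ?fact_gt0//.
have : (c * t) ^+ k.+1 / (k.+1)`!%:R <= expR (c * t).
  by apply: le_trans (expR_ge1Dxn k (ltW ct0)); rewrite lerDr.
by rewrite ler_pdivrMr ?ltr0n ?fact_gt0// factS natrM mulrA [expR _ * _]mulrC.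
Unshelve. all: by end_near. Qed.

End ProductLemmas.

(** * The coupling *)

(** Coordinate j of the difference is the sum of the x_i (M i j - y_j).  Apply
    Jensen with the weights x_i, then bound each (M i j - y_j)^2 by its share
    p_i >= c of the L^2(p) norm. *)
Lemma euclid_sq_limit_le (R : realType) (m : nat) (p : 'I_m.+1 -> R) (c : R)
    (x : 'rV[R]_m.+1) (M : 'M[R]_m.+1) (y : 'I_m.+1 -> R) :
  (forall i, 0 <= x ord0 i) -> 0 < c -> (forall i, c <= p i) ->
  euclid_sq (x *m M - (\sum_i x ord0 i) *: \row_j y j) <=
  limit_dist2 p M y / c * (\sum_i x ord0 i) ^+ 2.
Proof.
move=> x0 c0 cp; rewrite /euclid_sq /limit_dist2 -mulrA mulr_suml.
apply: ler_sum => j _; set D := dotp _ _ _.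
have aD i : (M i j - y j) ^+ 2 <= D / c.
  rewrite ler_pdivlMr// /D /dotp (bigD1 i)//= -expr2.
  apply: (@le_trans _ _ (p i * (M i j - y j) ^+ 2)).
    by rewrite mulrC ler_wpM2r// sqr_ge0.
  rewrite lerDl; apply: sumr_ge0 => l _; rewrite -expr2 mulr_ge0// ?sqr_ge0//.
  exact: le_trans (ltW c0) (cp l).
have -> : (x *m M - (\sum_i x ord0 i) *: \row_j y j) ord0 j =
    \sum_i x ord0 i * (M i j - y j).
  rewrite !mxE; under [RHS]eq_bigr do rewrite mulrBr.
  by rewrite sumrB -mulr_suml.
apply: le_trans (jensen_sqr _ x0) _.
have -> : D * (c^-1 * (\sum_i x ord0 i) ^+ 2) =
    (\sum_i x ord0 i) * ((\sum_i x ord0 i) * (D / c)) by ring.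
rewrite ler_wpM2l ?sumr_ge0// mulr_suml; apply: ler_sum => i _.
by rewrite ler_wpM2l.
Qed.

(** Applying the inequality to the complement reverses it. *)
Lemma complement_le_eq d (T : measurableType d) (R : realType) (L Q : set T -> \bar R) :
  (forall B, measurable B -> L B <= Q B)%E ->
  (forall B, measurable B -> L (~` B) = 1 - L B)%E ->
  (forall B, measurable B -> Q (~` B) = 1 - Q B)%E ->
  (forall B, measurable B -> Q B \is a fin_num) ->
  forall A, measurable A -> L A = Q A.
Proof.
move=> le LC QC Qfin A mA; apply/eqP; rewrite eq_le le//=.
have := le _ (measurableC mA); rewrite LC// QC//.
have := le _ mA; have := Qfin _ mA.
case: (Q A) => // q _; case: (L A) => [l| |] //=.
by rewrite -!EFinB !lee_fin => _; lra.
Qed.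

Section Coupling.
Context {d : measure_display} {T : measurableType d} {R : realType}.
Context {Pr : probability T R} {m : nat}.
Local Notation n := m.+1.
Local Notation U := (@unif01 R).
Variables (P : 'M[R]_n) (N : 'I_n -> R -> {RV Pr >-> nat}).
Variable (X : R -> {RV Pr >-> borelRV R n}).
Hypothesis hX : potlatch_process P N X.
Hypothesis hP : transition_matrix P.

Definition initial_sum (w : T) : R := \sum_j (X 0 w : 'rV[R]_n) ord0 j.

(** T carries X(0) and the second component the digits of the sites. *)
Definition coupled_state (k : nat) (z : T * measurableTypeR R) : borelRV R n :=
  (X 0 z.1 : 'rV[R]_n) *m rand_prod P k z.2.

Definition coupled_limit (z : T * measurableTypeR R) : borelRV R n :=
  initial_sum z.1 *: \row_j limit_row P z.2 j.

Lemma measurable_initial_coord j :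
  measurable_fun setT (fun w : T => (X 0 w : 'rV[R]_n) ord0 j).
Proof. exact: measurableT_comp (measurable_coord j) _. Qed.

Lemma measurable_initial_sum : measurable_fun setT initial_sum.
Proof. by apply: measurable_sum => j; exact: measurable_initial_coord. Qed.

Lemma measurable_coupled_state k : measurable_fun setT (coupled_state k).
Proof.
apply: measurable_rowP => j.
rewrite (_ : (fun w => _) = (fun z : T * measurableTypeR R => \sum_l (X 0 z.1 : 'rV[R]_n) ord0 l *
  rand_prod P k z.2 l j)).
  apply: measurable_sum => l; apply: measurable_funM.
    exact: measurableT_comp (measurable_initial_coord l) measurable_fst.
  exact: measurableT_comp (measurable_rand_prod P k (fun M => M l j)) measurable_snd.
by apply/funext => z; rewrite mxE.
Qed.

Lemma measurable_coupled_limit : measurable_fun setT coupled_limit.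
Proof.
apply: measurable_rowP => j.
rewrite (_ : (fun w => _) = (fun z : T * measurableTypeR R => initial_sum z.1 * limit_row P z.2 j)).
  apply: measurable_funM.
    exact: measurableT_comp measurable_initial_sum measurable_fst.
  exact: measurableT_comp (measurable_limit_row hP j) measurable_snd.
by apply/funext => z; rewrite !mxE.
Qed.

Lemma measurable_coupled_random :
  measurable_fun setT (fun z : T * measurableTypeR R * nat => coupled_state z.2 z.1).
Proof. by apply: measurable_nat_sections => k; exact: measurable_coupled_state. Qed.

Lemma coupled_state_law k (A : set (borelRV R n)) : measurable A ->
  (prod_prob Pr U (coupled_state k @^-1` A) =
   (iter k (lmean P) (initial_prob X A) 1%:M)%:E)%E.
Proof.
move=> mA; rewrite prod_prob_ysection; last first.
  by rewrite -[X in measurable X]setTI; exact: measurable_coupled_state.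
rewrite -(integral_rand_prod P k (initial_prob_ge0 X A)) -/unif01.
apply: eq_integral => x _; rewrite initial_probE//; congr (Pr _).
by apply/seteqP; split => w; rewrite /= /ysection/= inE.
Qed.

(** The law of the reversed product after a Poisson number of rings.  By
    [complement_le_eq] an inequality suffices, and the partial sums of the
    Poisson mixture are bounded by [poisson_sum_le]. *)
Lemma coupled_random_law (t : R) (A : set (borelRV R n)) : 0 <= t -> measurable A ->
  (prod_prob (prod_prob Pr U) (poisson_law (n%:R * t))
    ((fun z : T * measurableTypeR R * nat => coupled_state z.2 z.1) @^-1` A) =
   Pr (X t @^-1` A))%E.
Proof.
move=> t0.
pose L (A : set (borelRV R n)) :=
  (prod_prob (prod_prob Pr U) (poisson_law (n%:R * t))
    ((fun z : T * measurableTypeR R * nat => coupled_state z.2 z.1) @^-1` A))%E.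
have mL B : measurable B ->
    measurable ((fun z : T * measurableTypeR R * nat => coupled_state z.2 z.1) @^-1` B).
  by move=> mB; rewrite -[X in measurable X]setTI; exact: measurable_coupled_random.
have mXt B : measurable B -> measurable (X t @^-1` B).
  by move=> mB; exact: measurable_funPTI.
have le B : measurable B -> (L B <= Pr (X t @^-1` B))%E.
  move=> mB; rewrite /L prod_prob_ysection; last exact: mL.
  have a0 k : 0 <= iter k (lmean P) (initial_prob X B) 1%:M.
    have := @iter_lmean_le _ _ P k (fun=> 0) (initial_prob X B) (initial_prob_ge0 X B) 1%:M.
    by rewrite iter_lmean_cst.
  rewrite (eq_integral (fun k => (iter k (lmean P) (initial_prob X B) 1%:M)%:E)); last first.
    move=> k _; rewrite -(coupled_state_law k mB); congr (prod_prob Pr U _).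
    by apply/seteqP; split => z; rewrite /= /ysection/= inE.
  have /= -> := @integral_nat_valued _ nat R (poisson_law (n%:R * t)%R) id
    (fun k => (iter k (lmean P) (initial_prob X B) 1%:M)%:E) (@measurable_id _ _ setT) a0.
  apply: lime_le; first (apply: is_cvg_nneseries => k _ _; apply: mule_ge0;
    [by rewrite lee_fin|exact: measure_ge0]).
  apply: nearW => K; rewrite big_mkord.
  rewrite -[leRHS]fineK ?fin_num_measure//; last exact: mXt.
  move: t0; rewrite le_eqVlt => /orP[/eqP t0|t0].
    rewrite -t0 mulr0.
    under eq_bigr do rewrite [poisson_law 0 _]poisson_law0 -EFinM.
    rewrite sumEFin lee_fin.
    apply: (@le_trans _ _ (initial_prob X B 1%:M)); last first.
      rewrite /initial_prob le_eqVlt; apply/orP; left; apply/eqP; congr (fine (Pr _)).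
      by apply/seteqP; split => w; rewrite /= mulmx1.
    case: K => [|K]; first by rewrite big_ord0; exact: initial_prob_ge0.
    by rewrite big_ord_recl/= mulr1 big1 ?addr0// => k _; rewrite mulr0.
  under eq_bigr do rewrite [poisson_law (n%:R * t)%R _]poisson_law_gt0 ?mulr_gt0// -EFinM.
  rewrite sumEFin lee_fin.
  apply: le_trans (poisson_sum_le hX K t0 mB).
  by apply: ler_sum => k _; rewrite mulrC.
apply: (complement_le_eq le) => B mB.
- by have := probability_setC (prod_prob (prod_prob Pr U) (poisson_law (n%:R * t))) (mL _ mB).
- by have := probability_setC Pr (mXt _ mB).
- by apply: fin_num_measure; exact: mXt.
Qed.

End Coupling.

Section Bound.
Context {d : measure_display} {T : measurableType d} {R : realType}.
Context {Pr : probability T R} {m : nat}.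
Local Notation n := m.+1.
Local Notation U := (@unif01 R).
Variables (P : 'M[R]_n) (N : 'I_n -> R -> {RV Pr >-> nat}).
Variable (X : R -> {RV Pr >-> borelRV R n}).
Hypothesis hX : potlatch_process P N X.
Hypothesis hP : transition_matrix P.
Variables (p : 'I_n -> R) (mu c : R).
Hypotheses (hp : probability_vector p) (hrev : reversible P p).
Hypotheses (c_gt0 : 0 < c) (c_le : forall i, c <= p i).
Hypotheses (mu0 : 0 <= mu) (mu1 : mu < 1).
Hypothesis hmu : forall h, mean p h = 0 ->
  dotp p (avg P h) (avg P h) <= mu * dotp p h h.
Hypothesis hX0 : {ae Pr, forall w, forall i, 0 <= (X 0%R w : 'rV[R]_n) ord0 i}.

Let rho := 1 - (1 - mu) / n%:R.
Let p_gt0 i : 0 < p i. Proof. exact: lt_le_trans (c_le i). Qed.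

Definition coupling_dist2 (k : nat) (z : T * measurableTypeR R) : R :=
  euclid_sq ((coupled_state P X k z : 'rV[R]_n) - (coupled_limit P X z : 'rV[R]_n)).

Lemma coupling_dist2_ge0 k z : 0 <= coupling_dist2 k z.
Proof. by apply: sumr_ge0 => i _; exact: sqr_ge0. Qed.

Lemma measurable_coord_comp d' (T' : measurableType d') (f : T' -> borelRV R n) j :
  measurable_fun setT f -> measurable_fun setT (fun w => (f w : 'rV[R]_n) ord0 j).
Proof. by move=> mf; exact: measurableT_comp (measurable_coord j) mf. Qed.

Lemma measurable_coupling_dist2 k : measurable_fun setT (coupling_dist2 k).
Proof.
apply: measurable_sum => j.
rewrite (_ : (fun x => _) = (fun z => ((coupled_state P X k z : 'rV[R]_n) ord0 j -
    (coupled_limit P X z : 'rV[R]_n) ord0 j) ^+ 2)).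
  apply: measurable_funX; apply: measurable_funB; apply: measurable_coord_comp.
    exact: measurable_coupled_state.
  exact: measurable_coupled_limit.
by apply/funext => z; rewrite 3!mxE.
Qed.

Local Open Scope ereal_scope.

Let E2 := \int[Pr]_w ((initial_sum X w) ^+ 2)%:E.

Let E2_ge0 : 0 <= E2.
Proof. by apply: integral_ge0 => w _; rewrite lee_fin sqr_ge0. Qed.

(** X(0) and the digits are independent, so the bound of [euclid_sq_limit_le]
    integrates to a product. *)
Lemma integral_coupling_dist2_le k :
  \int[prod_prob Pr U]_z (coupling_dist2 k z)%:E <= (2 * rho ^+ k / c)%:E * E2.
Proof.
have mg : measurable_fun setT (fun z => (coupling_dist2 k z)%:E).
  by apply/measurable_EFinP; exact: measurable_coupling_dist2.
have g0 z : 0 <= (coupling_dist2 k z)%:E by rewrite lee_fin coupling_dist2_ge0.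
rewrite integral_prod_prob//.
pose h (x : R) := limit_dist2 p (rand_prod P k x) (limit_row P x).
have h0 x : (0 <= h x)%R by apply: limit_dist2_ge0.
have mh : measurable_fun setT h by apply: measurable_limit_dist2.
apply: (@le_trans _ _ (\int[U]_x ((h x / c)%:E * E2))).
  apply: ge0_le_integral => //.
  - by move=> x _; apply: integral_ge0 => w _.
  - exact: (measurable_inner_integral _ mg g0).
  - apply: emeasurable_funM => //; apply/measurable_EFinP.
    by apply: measurable_funM.
  move=> x _; rewrite -ge0_integralZl//; last 3 first.
  - by apply/measurable_EFinP; apply: measurable_funX; exact: measurable_initial_sum.
  - by move=> w _; rewrite lee_fin sqr_ge0.
  - by rewrite lee_fin divr_ge0// ltW.
  apply: ae_ge0_le_integral => //.
  - by apply: (measurableT_comp mg); exact: measurable_pair2.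
  - by move=> w _; rewrite -EFinM lee_fin mulr_ge0 ?sqr_ge0// divr_ge0// ltW.
  - apply: emeasurable_funM => //; apply/measurable_EFinP.
    by apply: measurable_funX; exact: measurable_initial_sum.
  have := hX0; apply: filterS => w hw _.
  by rewrite -EFinM lee_fin /coupling_dist2; apply: euclid_sq_limit_le.
rewrite ge0_integralZr//; last 2 first.
- by apply/measurable_EFinP; exact: measurable_funM.
- by move=> x _; rewrite lee_fin divr_ge0// ltW.
apply: lee_wpmul2r => //.
under eq_integral do rewrite mulrC EFinM.
rewrite ge0_integralZl//; last 3 first.
- exact/measurable_EFinP.
- by move=> x _; rewrite lee_fin.
- by rewrite lee_fin invr_ge0 ltW.
rewrite [in leRHS]mulrC [in leRHS]EFinM; apply: lee_wpmul2l.
  by rewrite lee_fin invr_ge0 ltW.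
exact: integral_limit_dist2_le.
Qed.

(** Average rho^K over K: n (1 - rho) = 1 - mu. *)
Lemma coupling_cost_le (t : R) : (0 <= t)%R ->
  \int[prod_prob (prod_prob Pr U) (poisson_law (n%:R * t)%R)]_z (coupling_dist2 z.2 z.1)%:E <=
  (2 / c)%:E * E2 * (expR (- ((1 - mu) * t)))%:E.
Proof.
move=> t0.
have mg : measurable_fun setT (fun z : T * measurableTypeR R * nat => (coupling_dist2 z.2 z.1)%:E).
  by apply: measurable_nat_sections => k; apply/measurable_EFinP; exact: measurable_coupling_dist2.
rewrite integral_prod_prob//=; last by move=> z; rewrite lee_fin coupling_dist2_ge0.
have r0 : (0 <= rho)%R by exact: rho_ge0.
pose D := (2 / c)%:E * E2.
have D0 : 0 <= D by rewrite mule_ge0// lee_fin divr_ge0// ltW.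
apply: (@le_trans _ _ (\int[poisson_law (n%:R * t)%R]_k ((rho ^+ k)%:E * D))).
  apply: ge0_le_integral => //.
  - by move=> k _; apply: integral_ge0 => z _; rewrite lee_fin coupling_dist2_ge0.
  move=> k _; apply: le_trans (integral_coupling_dist2_le k) _.
  rewrite /D muleA -EFinM; apply: lee_wpmul2r => //.
  by rewrite lee_fin le_eqVlt; apply/orP; left; apply/eqP; ring.
rewrite ge0_integralZr//; last by move=> k _; rewrite lee_fin exprn_ge0.
rewrite -/D muleC; apply: lee_wpmul2l => //.
have F0 k : 0 <= (rho ^+ k)%:E by rewrite lee_fin exprn_ge0.
have /= -> := @integral_nat_valued _ nat R (poisson_law (n%:R * t)%R) id
  (fun k => (rho ^+ k)%:E) (@measurable_id _ _ setT) F0.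
have x0 : (0 <= n%:R * t)%R by rewrite mulr_ge0.
apply: le_trans (poisson_geometric_le x0 r0) _.
by rewrite lee_fin ler_expR lerN2 le_eqVlt /rho; apply/orP; left; apply/eqP; field.
Qed.

End Bound.

(** * Weak convergence *)

Section WeakTools.
Context {R : realType}.

Lemma ae_snd d1 d2 (T1 : measurableType d1) (T2 : measurableType d2)
    (P1 : probability T1 R) (P2 : probability T2 R) (A : T2 -> Prop) :
  {ae P2, forall y, A y} -> {ae prod_prob P1 P2, forall z, A z.2}.
Proof.
move=> [Z [mZ Z0 sZ]]; exists (setT `*` Z); split.
- exact: measurableX.
- have -> : prod_prob P1 P2 (setT `*` Z) = (P1 setT * P2 Z)%E.
    exact: product_measure1E.
  by rewrite Z0 mule0.
- by move=> z /= nA; split => //; apply: sZ.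
Qed.

Lemma cvg_rV n (u : nat -> 'rV[R]_n) (v : 'rV[R]_n) :
  (forall j, u k ord0 j @[k --> \oo] --> v ord0 j) -> u k @[k --> \oo] --> v.
Proof.
move=> cu; apply/cvg_ballP => e e0.
have : \forall k \near \oo, forall j, ball (v ord0 j) e (u k ord0 j).
  by apply: filter_forall => j; have /cvg_ballP := cu j; apply.
by apply: filterS => k h; split => // i j; rewrite (ord1 i).
Qed.

Lemma poisson_law_lt_cvg0 (K : nat) (c : R) : 0 < c ->
  fine (poisson_law (c * t) [set k | (k < K)%N]) @[t --> +oo] --> 0.
Proof.
move=> c0; elim: K => [|K IH].
  rewrite (_ : [set k | (k < 0)%N] = set0); last by apply/seteqP; split.
  by under eq_fun do rewrite measure0; exact: cvg_cst.
have h : fine (poisson_law (c * t) [set k | (k < K)%N]) +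
    fine (poisson_law (c * t) [set K]) @[t --> +oo] --> (0 + 0 : R).
  by apply: cvgD => //; exact: poisson_law_cvg0.
rewrite addr0 in h.
apply: (squeeze_cvgr _ (@cvg_cst _ (0 : R) _ _ _) h).
apply: nearW => t; rewrite fine_ge0//= -lee_fin EFinD !fineK ?fin_num_measure//.
rewrite (_ : [set k | (k < K.+1)%N] = [set k | (k < K)%N] `|` [set K]).
  exact: measureU2.
apply/seteqP; split => k /=; rewrite [(k < K.+1)%N]ltnS [(k <= K)%N]leq_eqVlt.
  by move=> /orP[/eqP ->|]; [right|left].
by move=> [->|->]; rewrite ?eqxx ?orbT.
Qed.

Lemma bounded_integrable d (T : measurableType d) (Q : probability T R)
    (f : T -> R) (M : R) :
  measurable_fun setT f -> (forall x, `|f x| <= M) ->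
  Q.-integrable setT (EFin \o f).
Proof.
move=> mf fM; apply: measurable_bounded_integrable => //.
  by rewrite (le_lt_trans (probability_le1 _ _))// ltry.
by exists M; split; [exact: num_real|move=> x Mx y _; exact: le_trans (fM y) (ltW Mx)].
Qed.

Lemma expectation_diff_le d d' (T : measurableType d) (E : measurableType d')
    (Q : probability T R) (A B : T -> E) (f : E -> R) (M : R)
    (mA : measurable_fun setT A) (mB : measurable_fun setT B) :
  measurable_fun setT f -> (forall x, `|f x| <= M) ->
  `|fine (\int[Q]_z (f (A z))%:E) - fine (\int[Q]_z (f (B z))%:E)| <=
  fine (\int[Q]_z (`|f (A z) - f (B z)|)%:E).
Proof.
move=> mf fM.
have iA : Q.-integrable setT (EFin \o (f \o A)).
  by apply: (@bounded_integrable _ _ Q (f \o A) M (measurableT_comp mf mA)) => x; exact: fM.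
have iB : Q.-integrable setT (EFin \o (f \o B)).
  by apply: (@bounded_integrable _ _ Q (f \o B) M (measurableT_comp mf mB)) => x; exact: fM.
have iAB : Q.-integrable setT (EFin \o (fun z => f (A z) - f (B z))).
  by have := integrableB measurableT iA iB.
have -> : fine (\int[Q]_z (f (A z))%:E) - fine (\int[Q]_z (f (B z))%:E) =
    fine (\int[Q]_z (f (A z) - f (B z))%:E).
  rewrite -fineB; [|exact: integrable_fin_num iA|exact: integrable_fin_num iB].
  by congr fine; rewrite -integralB.
have absE : (\int[Q]_z (`|f (A z) - f (B z)|)%:E =
   \int[Q]_z `|(f (A z) - f (B z))%:E|)%E by [].
rewrite -lee_fin fineK; last first.
  rewrite absE; apply: (integrable_fin_num measurableT).
  exact: integrable_abse.
rewrite absE -[leLHS]/(`|(fine (\int[Q]_z (f (A z) - f (B z))%:E))%:E|%E).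
rewrite fineK; last exact: (integrable_fin_num measurableT).
by apply: le_abse_integral => //; case/integrableP: iAB.
Qed.

End WeakTools.

Definition mfun_of d d' (T : measurableType d) (T' : measurableType d') (f : T -> T')
    (mf : measurable_fun setT f) : {mfun T >-> T'} :=
  HB.pack f (isMeasurableFun.Build _ _ _ _ f mf).

Section Transfer.
Context {R : realType} (d1 d2 d3 : measure_display) (T1 : measurableType d1)
  (T2 : measurableType d2).
Context (E : measurableType d3) (Q1 : probability T1 R) (Q2 : probability T2 R).
Variables (A : T1 -> E) (B : T2 -> E) (f : E -> R) (M : R).
Hypotheses (mA : measurable_fun setT A) (mB : measurable_fun setT B).
Hypothesis same_law : forall S, measurable S -> Q1 (A @^-1` S) = Q2 (B @^-1` S).
Hypotheses (mf : measurable_fun setT f) (fM : forall x, `|f x| <= M).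

Lemma integral_bounded_distribution :
  (\int[distribution Q1 (mfun_of mA)]_x (f x)%:E = \int[Q1]_z (f (A z))%:E)%E.
Proof.
apply: integral_distribution; first exact/measurable_EFinP.
by apply: (@bounded_integrable _ _ _ Q1 (f \o A) M (measurableT_comp mf mA)) => x; exact: fM.
Qed.

End Transfer.

Lemma integral_same_law (R : realType) (d1 d2 d3 : measure_display) (T1 : measurableType d1)
  (T2 : measurableType d2)
    (E : measurableType d3) (Q1 : probability T1 R) (Q2 : probability T2 R)
    (A : T1 -> E) (B : T2 -> E) (f : E -> R) (M : R) :
  measurable_fun setT A -> measurable_fun setT B ->
  (forall S, measurable S -> Q1 (A @^-1` S) = Q2 (B @^-1` S)) ->
  measurable_fun setT f -> (forall x, `|f x| <= M) ->
  (\int[Q1]_z (f (A z))%:E = \int[Q2]_z (f (B z))%:E)%E.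
Proof.
move=> mA mB law mf fM.
rewrite -(integral_bounded_distribution Q1 mA mf fM).
rewrite -(integral_bounded_distribution Q2 mB mf fM).
by apply: eq_measure_integral => S mS _; exact: law.
Qed.

Section Weak.
Context {d : measure_display} {T : measurableType d} {R : realType}.
Context {Pr : probability T R} {m : nat}.
Local Notation n := m.+1.
Local Notation U := (@unif01 R).
Variables (P : 'M[R]_n) (N : 'I_n -> R -> {RV Pr >-> nat}).
Variable (X : R -> {RV Pr >-> borelRV R n}).
Hypothesis hX : potlatch_process P N X.
Hypothesis hP : transition_matrix P.
Variables (p : 'I_n -> R) (mu : R).
Hypotheses (hp : probability_vector p) (hrev : reversible P p).
Hypotheses (p_gt0 : forall i, 0 < p i).
Hypotheses (mu0 : 0 <= mu) (mu1 : mu < 1).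
Hypothesis hmu : forall h, mean p h = 0 ->
  dotp p (avg P h) (avg P h) <= mu * dotp p h h.

Lemma coupled_state_cvg : {ae prod_prob Pr U, forall z,
  (coupled_state P X k z : 'rV[R]_n) @[k --> \oo] --> (coupled_limit P X z : 'rV[R]_n)}.
Proof.
have : {ae U, forall x, forall i j, rand_prod P k x i j @[k --> \oo] --> limit_row P x j}.
  exact: (rand_prod_cvg hP hp hrev p_gt0 mu0 mu1 hmu).
move=> /(ae_snd Pr); apply: filterS => -[w x] /= cv.
apply: cvg_rV => j; rewrite /coupled_limit /coupled_state /initial_sum /= !mxE mulr_suml.
under eq_fun do rewrite mxE.
apply: cvg_big => [|l _]; first exact: add_continuous.
exact: (@cvgM R _ \oo _ (cst ((X 0 w : 'rV[R]_n) ord0 l)) _ _ _ (cvg_cst _) (cv l j)).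
Qed.

Variables (f : 'rV[R]_n -> R) (M : R).
Hypotheses (cf : continuous f) (fM : forall x, `|f x| <= M).

Let mf : measurable_fun setT (f : borelRV R n -> R).
Proof. exact: continuous_measurable_rV. Qed.

Definition test_gap (k : nat) (z : T * measurableTypeR R) : R :=
  `|f (coupled_state P X k z) - f (coupled_limit P X z)|.

Lemma test_gap_ge0 k z : 0 <= test_gap k z.
Proof. exact: normr_ge0. Qed.

Lemma test_gap_le k z : `|test_gap k z| <= 2 * M.
Proof.
rewrite normr_id (le_trans (ler_normB _ _))// mulr2n mulrDl mul1r.
by apply: lerD; exact: fM.
Qed.

Lemma measurable_test_gap k : measurable_fun setT (test_gap k).
Proof.
apply: measurableT_comp => //; apply: measurable_funB.
  exact: (measurableT_comp mf (measurable_coupled_state P X k)).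
exact: (measurableT_comp mf (measurable_coupled_limit X hP)).
Qed.

Lemma integral_test_gap_cvg0 :
  (\int[prod_prob Pr U]_z (test_gap k z)%:E @[k --> \oo] --> 0)%E.
Proof.
have h1 k : measurable_fun setT (fun z => (test_gap k z)%:E).
  by apply/measurable_EFinP; exact: measurable_test_gap.
have h2 : {ae prod_prob Pr U, forall z, setT z -> (test_gap k z)%:E @[k --> \oo] -->
  (0%:E : \bar R)}.
  have := coupled_state_cvg; apply: filterS => z cz _.
  apply: cvg_EFin; first exact: nearW.
  rewrite /comp/= -(normr0 R) -(subrr (f (coupled_limit P X z))).
  apply: cvg_norm; apply: cvgB; last exact: cvg_cst.
  exact: (cvg_comp _ _ cz (@cf (coupled_limit P X z))).
have h3 : (prod_prob Pr U).-integrable setT (cst (2 * M)%:E).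
  exact: (@bounded_integrable _ _ _ (prod_prob Pr U) (cst (2 * M)) `|2 * M|).
have h4 : {ae prod_prob Pr U, forall z k, setT z -> (`|(test_gap k z)%:E| <= cst (2 * M)%:E z)%E}.
  by apply: aeW => z k _; rewrite lee_fin test_gap_le.
have [_ _] := dominated_convergence measurableT h1 (measurable_cst _) h2 h3 h4.
by rewrite integral0.
Qed.

(** The values of k below K have small probability for large t and cost at most
    C; the others cost at most e. *)
Lemma poisson_mean_le (t : R) (g : nat -> \bar R) (C e : R) (K : nat) :
  0 <= C -> 0 <= e -> (forall k, (0 <= g k)%E) -> (forall k, (g k <= C%:E)%E) ->
  (forall k, (K <= k)%N -> (g k <= e%:E)%E) ->
  (\int[poisson_law (n%:R * t)]_k g k <=
   C%:E * poisson_law (n%:R * t) [set k | (k < K)%N] + e%:E)%E.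
Proof.
move=> C0 e0 g0 gC ge; set kappa := poisson_law _.
apply: (@le_trans _ _ (\int[kappa]_k (C%:E * (\1_[set k | (k < K)%N] k)%:E + e%:E))%E).
  apply: ge0_le_integral => // k _.
  rewrite indicE; case: (ltnP k K) => kK.
    by rewrite mem_set// mule1 (le_trans (gC k))// leeDl// lee_fin.
  by rewrite memNset ?mule0 ?add0e ?ge//= ltnNge kK.
rewrite ge0_integralD//; last first.
  by move=> k _; rewrite mule_ge0// lee_fin.
rewrite ge0_integralZl//.
rewrite integral_indic// setIT integral_cst//.
by rewrite [X in (e%:E * X)%E](_ : _ = 1%E) ?mule1//; exact: probability_setT.
Qed.

(** Couple X(t) with the limit as in [coupled_random_law]; the difference of the
    two expectations is at most a Poisson mean of the numbers g k, which tend
    to 0 by dominated convergence. *)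
Lemma expectation_cvg :
  (\int[Pr]_w (f (X t w))%:E @[t --> +oo%R] -->
   \int[prod_prob Pr U]_z (f (coupled_limit P X z))%:E)%E.
Proof.
have M0 : 0 <= M := le_trans (normr_ge0 (f 0)) (fM 0).
have mZ := measurable_coupled_limit X hP.
have iZ : (prod_prob Pr U).-integrable setT (EFin \o (f \o coupled_limit P X)).
  by apply: (@bounded_integrable _ _ _ _ _ M (measurableT_comp mf mZ)) => z; exact: fM.
have iX t : Pr.-integrable setT (EFin \o (f \o X t)).
  by apply: (@bounded_integrable _ _ _ _ _ M) => [|z]; [exact: measurableT_comp|exact: fM].
have hfin t : (\int[Pr]_w (f (X t w))%:E)%E \is a fin_num.
  by apply: integrable_fin_num (iX t).
have lfin : (\int[prod_prob Pr U]_z (f (coupled_limit P X z))%:E)%E \is a fin_num.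
  by apply: integrable_fin_num iZ.
rewrite -(fineK lfin); apply: cvg_EFin; first exact: nearW.
pose g k := (\int[prod_prob Pr U]_z (test_gap k z)%:E)%E.
have g0 k : (0 <= g k)%E by apply: integral_ge0 => z _; rewrite lee_fin test_gap_ge0.
have gC k : (g k <= (2 * M)%:E)%E.
  rewrite /g; apply: (@le_trans _ _ (\int[prod_prob Pr U]_z (cst (2 * M)%:E z))%E).
    apply: ge0_le_integral => //.
    - by move=> z _; rewrite lee_fin test_gap_ge0.
    - by apply/measurable_EFinP; exact: measurable_test_gap.
    - by move=> z _; rewrite lee_fin (le_trans (ler_norm _))// test_gap_le.
  rewrite integral_cst// [X in (_ * X)%E](_ : _ = 1%E) ?mule1//.
  exact: probability_setT.
apply/cvgrPdist_le => e e0.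
have [K geK] : exists K, forall k, (K <= k)%N -> (g k <= (e / 2)%:E)%E.
  have /fine_cvgP[gfin] := integral_test_gap_cvg0.
  move=> /cvgrPdist_le/(_ (e / 2)) h.
  have [K _ hK] : \forall k \near \oo, g k \is a fin_num /\ `|0 - fine (g k)| <= e / 2.
    by apply: filterI => //; apply: h; rewrite divr_gt0.
  exists K => k Kk; have [gf] := hK k Kk.
  by rewrite sub0r normrN ger0_norm ?fine_ge0// -lee_fin fineK.
have hq : \forall t \near +oo, 2 * M * fine (poisson_law (n%:R * t) [set k | (k < K)%N]) <= e / 2.
  have c1 : 2 * M * fine (poisson_law (n%:R * t) [set k | (k < K)%N]) @[t --> +oo] -->
    (2 * M * 0 : R).
    apply: (@cvgM R _ _ _ (cst (2 * M)) _ _ _ (cvg_cst _)).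
    exact: poisson_law_lt_cvg0.
  rewrite mulr0 in c1; have e2 : 0 < e / 2 by rewrite divr_gt0.
  have /cvgrPdist_le/(_ _ e2) := c1; apply: filterS => t.
  by rewrite sub0r normrN; exact/le_trans/ler_norm.
near=> t.
have t0 : 0 <= t by apply: ltW; near: t; exact: nbhs_pinfty_gt.
pose Om := prod_prob (prod_prob Pr U) (poisson_law (n%:R * t)).
pose A (z : T * measurableTypeR R * nat) := coupled_state P X z.2 z.1.
pose B (z : T * measurableTypeR R * nat) := coupled_limit P X z.1.
have mA : measurable_fun setT A by exact: measurable_coupled_random.
have mB : measurable_fun setT B by exact: (measurableT_comp mZ measurable_fst).
have -> : (\int[prod_prob Pr U]_z (f (coupled_limit P X z))%:E = \int[Om]_z (f (B z))%:E)%E.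
  apply: (integral_same_law mZ mB _ mf fM) => S mS.
  have mZS : measurable (coupled_limit P X @^-1` S).
    by rewrite -[X in measurable X]setTI; exact: mZ.
  rewrite -(prod_prob_setXT (prod_prob Pr U) (poisson_law (n%:R * t)) mZS).
  by congr (Om _); apply/seteqP; split => z /=; [case|].
rewrite [X in _ - X](_ : _ = fine (\int[Om]_z (f (A z))%:E)%E); last first.
  rewrite /comp; congr fine; apply: (integral_same_law _ mA _ mf fM) => // S mS.
  by rewrite (coupled_random_law hX t0 mS).
rewrite distrC; apply: (le_trans (expectation_diff_le Om mA mB mf fM)).
have mG : measurable_fun setT (fun z : T * measurableTypeR R * nat => (test_gap z.2 z.1)%:E).
  by apply: measurable_nat_sections => k; apply/measurable_EFinP; exact: measurable_test_gap.
rewrite (integral_prod_prob _ _ mG); last by move=> z; rewrite lee_fin test_gap_ge0.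
have e20 : 0 <= e / 2 by rewrite divr_ge0// ltW.
have M20 : 0 <= 2 * M by rewrite mulr_ge0.
have := poisson_mean_le t M20 e20 g0 gC geK.
have qe : 2 * M * fine (poisson_law (n%:R * t) [set k | (k < K)%N]) <= e / 2.
  near: t; exact: hq.
set q := poisson_law _ _ in qe *; have qfin : q \is a fin_num by exact: fin_num_measure.
set v := (\int[_]_k g k)%E => v_le.
have v0 : (0 <= v)%E by apply: integral_ge0 => k _; exact: g0.
have {}v_le : (v <= e%:E)%E.
  apply: le_trans v_le _; rewrite -(fineK qfin) -EFinM -EFinD lee_fin.
  by move: qe; lra.
rewrite -lee_fin fineK// ge0_fin_numE// (le_lt_trans v_le)// ltry.
Unshelve. all: by end_near. Qed.

End Weak.

(** * The Wasserstein bound *)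

Section PiBounds.
Context {R : realType} {m : nat}.
Local Notation n := m.+1.
Variable p : 'I_n -> R.

Lemma pi_min_le i : pi_min p <= p i.
Proof. exact: bigmin_le_cond. Qed.

Lemma pi_min_gt0 : (forall i, 0 < p i) -> 0 < pi_min p.
Proof. by move=> p0; apply: lt_bigmin => //; exact: ltr01. Qed.

Lemma pi_max_ge : probability_vector p -> 1 <= pi_max p * n%:R.
Proof.
move=> [_ p1]; rewrite -[leLHS]p1; apply: (@le_trans _ _ (\sum_(i < n) pi_max p)).
  by apply: ler_sum => i _; exact: le_bigmax_cond.
by rewrite sumr_const card_ord mulr_natr.
Qed.

Lemma pi_max_ge0 : 0 <= pi_max p.
Proof. exact: bigmax_ge_id. Qed.

End PiBounds.

Section Wasserstein.
Context {d : measure_display} {T : measurableType d} {R : realType}.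
Context {Pr : probability T R} {m : nat}.
Local Notation n := m.+1.
Local Notation U := (@unif01 R).
Variables (P : 'M[R]_n) (N : 'I_n -> R -> {RV Pr >-> nat}).
Variable (X : R -> {RV Pr >-> borelRV R n}).
Hypothesis hX : potlatch_process P N X.
Hypothesis hP : transition_matrix P.

Lemma measurable_coupled_pair : measurable_fun setT
  (fun z : T * measurableTypeR R * nat =>
     (coupled_state P X z.2 z.1, coupled_limit P X z.1)).
Proof.
apply: measurable_fun_pair => //.
  exact: measurable_coupled_random.
exact: (measurableT_comp (measurable_coupled_limit X hP) measurable_fst).
Qed.

Lemma measurable_euclid_sq_sub : measurable_fun setT
  (fun z : borelRV R n * borelRV R n =>
     euclid_sq ((z.1 : 'rV[R]_n) - (z.2 : 'rV[R]_n))).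
Proof.
apply: measurable_sum => j.
rewrite (_ : (fun x => _) = (fun z : borelRV R n * borelRV R n =>
   ((z.1 : 'rV[R]_n) ord0 j - (z.2 : 'rV[R]_n) ord0 j) ^+ 2)).
  apply: measurable_funX; apply: measurable_funB.
    exact: (measurableT_comp (measurable_coord j) measurable_fst).
  exact: (measurableT_comp (measurable_coord j) measurable_snd).
by apply/funext => z; rewrite 2!mxE.
Qed.

(** The two marginals of the law of the coupled pair are the laws of X(t) and of
    the limit. *)
Lemma wasserstein2_le_cost (t : R) : 0 <= t ->
  (wasserstein2 (distribution Pr (X t))
     (distribution (prod_prob Pr U) (mfun_of (measurable_coupled_limit X hP))) <=
   sqrte (\int[prod_prob (prod_prob Pr U) (poisson_law (n%:R * t))]_z
            (coupling_dist2 P X z.2 z.1)%:E))%E.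
Proof.
move=> t0; set Om := prod_prob _ (poisson_law _).
rewrite /wasserstein2 lee_sqrt; last first.
  by apply: integral_ge0 => z _; rewrite lee_fin coupling_dist2_ge0.
apply: ereal_inf_lbound.
exists (distribution Om (mfun_of measurable_coupled_pair)).
  split => S mS.
    transitivity (Om ((fun z => coupled_state P X z.2 z.1) @^-1` S)).
      by congr (Om _); apply/seteqP; split => z /=; [case|].
    exact: (coupled_random_law hX t0 mS).
  have mZS : measurable (coupled_limit P X @^-1` S).
    by rewrite -[X in measurable X]setTI; exact: measurable_coupled_limit.
  transitivity (Om ((coupled_limit P X @^-1` S) `*` setT)).
    by congr (Om _); apply/seteqP; split => z /=; [case|case=> ? _; split].
  exact: prod_prob_setXT.
apply: ge0_integral_distribution.
  by apply/measurable_EFinP; exact: measurable_euclid_sq_sub.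
by move=> z; rewrite lee_fin; apply: sumr_ge0 => i _; exact: sqr_ge0.
Qed.

End Wasserstein.

Theorem theorem2p3 (R : realType) (n : nat) (hn : (2 <= n)%N)
    (P : 'M[R]_n) (p : 'I_n -> R)
    (hP : transition_matrix P) (hirr : irreducible P) (haper : aperiodic P)
    (hp : probability_vector p) (hrev : reversible P p)
    (d : measure_display) (T : measurableType d) (Pr : probability T R)
    (N : 'I_n -> R -> {RV Pr >-> nat}) (X : R -> {RV Pr >-> borelRV R n})
    (hX : potlatch_process P N X)
    (hX0 : {ae Pr, forall w, forall i, 0 <= (X 0%R w : 'rV[R]_n) ord0 i}) :
  exists (d' : measure_display) (T' : measurableType d')
      (Pr' : probability T' R) (Xinf : {RV Pr' >-> borelRV R n}),
    weak_cvg (fun t => distribution Pr (X t)) (distribution Pr' Xinf) /\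
    forall t : R, 0 <= t ->
      (wasserstein2 (distribution Pr (X t)) (distribution Pr' Xinf) <=
       sqrte ((2 * pi_max p / pi_min p * n%:R)%:E *
              'E_Pr[fun w => ((\sum_j (X 0%R w : 'rV[R]_n) ord0 j) ^+ 2)%R]) *
       (expR (- gap2 P * t / 2))%:E)%E.
Proof.
case: n => [//|m] in hn P p hP hirr haper hp hrev N X hX hX0 *.
have [mu [mu0 mu1 mu_lambda hmu]] := spectral_gap hP hp hrev hirr haper.
have p_gt0 := stationary_gt0 hP hp hrev hirr.
have c0 := pi_min_gt0 p_gt0.
exists _, _, (prod_prob Pr (@unif01 R)), (mfun_of (measurable_coupled_limit X hP)).
split.
  move=> f cf [M fM].
  have mf := continuous_measurable_rV cf.
  rewrite (integral_bounded_distribution _ (measurable_coupled_limit X hP) mf fM).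
  have := expectation_cvg hX hP hp hrev p_gt0 mu0 mu1 hmu cf fM.
  apply: cvg_trans; apply: near_eq_cvg; apply: nearW => t.
  by rewrite -(integral_bounded_distribution Pr (measurable_funP (X t)) mf fM).
move=> t t0; apply: le_trans (wasserstein2_le_cost hX hP t0) _.
set E2 := ('E_Pr[_])%E.
have E2E : E2 = (\int[Pr]_w ((initial_sum X w) ^+ 2)%:E)%E by rewrite /E2 unlock.
have E20 : (0 <= E2)%E.
  by rewrite E2E; apply: integral_ge0 => w _; rewrite lee_fin sqr_ge0.
have cost := coupling_cost_le hP hp hrev c0 (pi_min_le p) mu0 mu1 hmu hX0 t0.
have C0 : 0 <= 2 * pi_max p / pi_min p * m.+1%:R.
  by rewrite mulr_ge0// divr_ge0 ?mulr_ge0 ?pi_max_ge0// ltW.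
have -> : (expR (- gap2 P * t / 2))%:E = sqrte (expR (- gap2 P * t))%:E.
  have -> : - gap2 P * t = 2%:R * (- gap2 P * t / 2) by field.
  rewrite /sqrte expRM_natl sqrtr_sqr ger0_norm ?expR_ge0//.
  by congr (expR _)%:E; field.
rewrite -sqrteM ?mule_ge0 ?lee_fin//.
rewrite lee_sqrt; last by rewrite !mule_ge0 ?lee_fin ?expR_ge0.
apply: le_trans cost _; rewrite -E2E.
apply: lee_pmul.
- by rewrite mule_ge0// lee_fin divr_ge0// ltW.
- by rewrite lee_fin expR_ge0.
- apply: lee_wpmul2r => //; rewrite lee_fin.
  rewrite (_ : _ * m.+1%:R = 2 / pi_min p * (pi_max p * m.+1%:R)); last by ring.
  by rewrite ler_peMr ?pi_max_ge// divr_ge0// ltW.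
- rewrite lee_fin ler_expR mulNr lerN2 ler_wpM2r// /gap2 lerD2l lerN2//.
Qed.
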